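(* Let $M$ be a connected manifold and let $F$ be a homogeneous isotropic Berwald metric on $M$; that is, $F$ is a Finsler metric whose isometry group $I(M,F)$ acts transitively on $M$, and there is a function $\Phi\in C^\infty(M)$ such that for all $x\in M$, $0\neq y\in T_xM$ and $u,v,w\in T_xM$, $$\mathbf{B}_y(u,v,w)=\Phi(x) F^{-1}\Big\{\mathbf{h}_y(u,v)\mathfrak{B}_y(w)+\mathbf{h}_y(v,w)\mathfrak{B}_y(u)+\mathbf{h}_y(w,u)\mathfrak{B}_y(v)+2F\,\mathbf{C}_y(u,v,w)\,\ell\Big\}.$$ Then $F$ is either locally Minkowskian, or Riemannian, or a Berwald metric, or a Randers metric of Berwald type.
   Context: Let $M$ be an $n$-dimensional $C^\infty$ manifold, $TM_0=TM\setminus\{0\}$ the slit tangent bundle, with local coordinates $(x^i,y^i)$. A Finsler metric is a function $F:TM\to[0,\infty)$ that is $C^\infty$ on $TM_0$, satisfies $F(x,\lambda y)=\lambda F(x,y)$ for all $\lambda>0$, and such that for every $y\in T_xM\setminus\{0\}$ the form $\mathbf{g}_y(u,v)=\frac12\frac{\partial^2}{\partial s\partial t}F^2(y+su+tv)|_{s=t=0}$ is positive definite on $T_xM$; write $g_{ij}(x,y)$ for its components and $g^{ij}$ for the inverse matrix. $F$ is Riemannian if $F^2(x,y)$ is a positive definite quadratic form in $y$ for each $x$. $F$ is locally Minkowskian if around each point there are local coordinates $(x^i)$ in which $F(x,y)$, in the induced coordinates $(x^i,y^i)$, depends only on $y$. $I(M,F)$ is the group of diffeomorphisms $\varphi$ of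 $M$ with $F(\varphi(x),d\varphi_x(y))=F(x,y)$ for all $(x,y)\in TM$. The Cartan torsion is $\mathbf{C}_y(u,v,w)=\frac12\frac{d}{dt}[\mathbf{g}_{y+tw}(u,v)]_{t=0}$. The angular form is $\mathbf{h}_y(u,v)=\mathbf{g}_y(u,v)-F^{-2}(y)\mathbf{g}_y(y,u)\mathbf{g}_y(y,v)$. Also $\ell=\ell(x,y)=y/F(x,y)$ and $\mathfrak{B}_y(w)=w-\mathbf{g}_y(w,\ell)\ell$. The spray coefficients are $G^i=\frac14 g^{im}\left\{\frac{\partial^2 F^2}{\partial x^k\partial y^m}y^k-\frac{\partial F^2}{\partial x^m}\right\}$. The Berwald curvature is $\mathbf{B}_y(u,v,w)=B^i_{\ jkl}(y)u^jv^kw^l\frac{\partial}{\partial x^i}$ with $B^i_{\ jkl}=\frac{\partial^3G^i}{\partial y^j\partial y^k\partial y^l}$. $F$ is a Berwald metric if $\mathbf{B}=0$ on $TM_0$. A Randers metric is a Finsler metric of the form $F=\alpha+\beta$, where $\alpha=\sqrt{a_{ij}(x)y^iy^j}$ is a Riemannian metric and $\beta=b_i(x)y^i$ is a $1$-form on $M$; it is of Berwald type if it is also a Berwald metric. *)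

(* Defs.v *)
From HB Require Import structures.
From mathcomp Require Import all_boot all_order all_algebra.
From mathcomp Require Import all_classical all_reals all_analysis.

Set Implicit Arguments.
Unset Strict Implicit.
Unset Printing Implicit Defensive.

Import Order.TTheory GRing.Theory Num.Theory.
Import numFieldNormedType.Exports.
Local Open Scope classical_set_scope.
Local Open Scope ring_scope.

Section Smooth.
Context {R : realType} {V W : normedModType R}.

(* For V finite-dimensional, Ck k U f is the usual "f is C^k on the open set U":
   f is Frechet differentiable on U and all its directional derivatives are
   C^(k-1) there. *)
Fixpoint Ck (k : nat) (U : set V) (f : V -> W) : Prop :=
  if k is k'.+1 then
    (forall x, U x -> differentiable f x) /\ (forall v, Ck k' U ('D_v f))
  else forall x, U x -> {for x, continuous f}.

Definition smooth_on (U : set V) (f : V -> W) : Prop := forall k, Ck k U f.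

End Smooth.

Section Manifold.
Context (R : realType) (n : nat) (M : topologicalType).

(* A homeomorphism from the open set [dom] onto an open subset of R^n, with
   inverse [bwd]; the values of [fwd] outside [dom] and of [bwd] outside the
   image of [dom] are irrelevant. *)
Record chart := Chart {
  dom : set M;
  fwd :> M -> 'rV[R]_n;
  bwd : 'rV[R]_n -> M;
  dom_open : open dom;
  img_open : open (fwd @` dom);
  bwdK : forall p, dom p -> bwd (fwd p) = p;
  fwd_cont : {within dom, continuous fwd};
  bwd_cont : {within fwd @` dom, continuous bwd} }.

Definition smooth_transition (c c' : chart) : Prop :=
  smooth_on (c @` (dom c `&` dom c')) (c' \o bwd c).

Record manifold := Manifold {
  atlas : set chart;
  mfd_hausdorff : hausdorff_space M;
  mfd_second_countable : @second_countable M;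
  atlas_cover : forall p, exists2 c, atlas c & dom c p;
  atlas_compat : forall c c', atlas c -> atlas c' -> smooth_transition c c';
  atlas_maximal : forall c,
    (forall c', atlas c' -> smooth_transition c c' /\ smooth_transition c' c) ->
    atlas c }.

End Manifold.
Arguments dom {R n M} c _.
Arguments bwd {R n M} c _.

Section Tangent.
Context {R : realType} {n : nat} {M : topologicalType} (A : manifold R n M).
Implicit Types (p : M) (c : chart R n M).

Definition chart_at p : set (chart R n M) := [set c | atlas A c /\ dom c p].

(* A tangent vector at p is the family of its coordinate vectors in all the
   charts around p, which transform by the differentials of the transition maps
   (with the convention 0 for the other charts). *)
Definition tangent_pred p : {pred chart R n M -> 'rV[R]_n} :=
  [pred v | `[< (forall c, ~ chart_at p c -> v c = 0) /\
     forall c c', chart_at p c -> chart_at p c' ->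
       v c' = 'd (c' \o bwd c) (c p) (v c) >] ].

Lemma tangent_submod_closed p : submod_closed (tangent_pred p).
Proof.
split=> [|a u v].
  by apply/asboolP; split=> // c c' _ _; rewrite linear0.
move=> /asboolP[u0 uE] /asboolP[v0 vE]; apply/asboolP; split=> [c cp|c c' cp c'p].
  by rewrite !fctE u0// v0// scaler0 addr0.
by rewrite !fctE linearP (uE _ _ cp c'p) (vE _ _ cp c'p).
Qed.

HB.instance Definition _ p :=
  GRing.isSubmodClosed.Build _ _ (tangent_pred p) (tangent_submod_closed p).

Record tangent p := Tangent {
  coord :> chart R n M -> 'rV[R]_n;
  coordP : coord \in tangent_pred p }.

HB.instance Definition _ p := [isSub of tangent p for @coord p].
HB.instance Definition _ p := [Choice of tangent p by <:].
HB.instance Definition _ p := [SubChoice_isSubLmodule of tangent p by <:].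

(* The vector y^i d/dx^i at p, where x^i are the coordinates of c. *)
Definition tvec c p (y : 'rV[R]_n) : tangent p :=
  xget 0 [set v : tangent p | v c = y].

(* The differential of phi at p. *)
Definition tmap (phi : M -> M) p (v : tangent p) : tangent (phi p) :=
  xget 0 [set w : tangent (phi p) |
    forall c c', chart_at p c -> chart_at (phi p) c' ->
      w c' = 'd (c' \o phi \o bwd c) (c p) (v c)].

Definition smooth_map (phi : M -> M) : Prop :=
  continuous phi /\
  forall c c', atlas A c -> atlas A c' ->
    smooth_on (c @` (dom c `&` phi @^-1` dom c')) (c' \o phi \o bwd c).

Definition diffeomorphism (phi : M -> M) : Prop :=
  smooth_map phi /\
  exists psi, [/\ smooth_map psi, cancel phi psi & cancel psi phi].

Definition smooth_fun (f : M -> R) : Prop :=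
  forall c, atlas A c -> smooth_on (c @` dom c) (f \o bwd c : _ -> R^o).

Definition one_form (b : forall p, tangent p -> R) : Prop :=
  (forall p, scalar (b p)) /\
  forall c y, atlas A c ->
    smooth_on (c @` dom c) (fun x => b (bwd c x) (tvec c _ y) : R^o).

Definition inner_product p (a : tangent p -> tangent p -> R) : Prop :=
  [/\ forall u, scalar (a u), forall u v, a u v = a v u
    & forall u, u <> 0 -> 0 < a u u].

Definition riemannian_tensor (a : forall p, tangent p -> tangent p -> R) : Prop :=
  (forall p, inner_product (a p)) /\
  forall c y z, atlas A c ->
    smooth_on (c @` dom c)
      (fun x => a (bwd c x) (tvec c _ y) (tvec c _ z) : R^o).

End Tangent.
Arguments tvec {R n M} A c p y.

Section Finsler.
Context {R : realType} {n : nat} {M : topologicalType} (A : manifold R n M).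
Variable F : forall p, tangent A p -> R.
Arguments F {p} _.
Implicit Types (p : M) (c : chart R n M) (i j k l m : 'I_n).

Definition e_ i : 'rV[R]_n := delta_mx 0 i.

(* F in the coordinates (x^i, y^i) of TM induced by c. *)
Definition Floc c (x y : 'rV[R]_n) : R := F (tvec A c (bwd c x) y).

Definition fund_tensor p (y u v : tangent A p) : R :=
  2^-1 * derive1 (fun s : R =>
    derive1 (fun t : R => F (y + s *: u + t *: v) ^+ 2 : R^o) 0 : R^o) 0.

Definition finsler_metric : Prop :=
  [/\ forall p (y : tangent A p), 0 <= F y,
      forall c, atlas A c ->
        smooth_on [set z : 'rV[R]_n * 'rV[R]_n | (c @` dom c) z.1 /\ z.2 <> 0]
          (fun z => Floc c z.1 z.2 : R^o),
      forall p (y : tangent A p) (r : R), 0 < r -> F (r *: y) = r * F y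
    & forall p (y u : tangent A p), y <> 0 -> u <> 0 -> 0 < fund_tensor y u u].

Definition cartan_torsion p (y u v w : tangent A p) : R :=
  2^-1 * derive1 (fun t : R => fund_tensor (y + t *: w) u v : R^o) 0.

Definition angular_form p (y u v : tangent A p) : R :=
  fund_tensor y u v - (F y ^+ 2)^-1 * fund_tensor y y u * fund_tensor y y v.

Definition ell p (y : tangent A p) : tangent A p := (F y)^-1 *: y.

Definition frakB p (y w : tangent A p) : tangent A p :=
  w - fund_tensor y w (ell y) *: ell y.

Definition gmat c (x y : 'rV[R]_n) : 'M[R]_n :=
  \matrix_(i, j) fund_tensor (tvec A c (bwd c x) y)
    (tvec A c _ (e_ i)) (tvec A c _ (e_ j)).

Definition F2 c (x y : 'rV[R]_n) : R^o := Floc c x y ^+ 2.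

Definition spray_coef c i (x y : 'rV[R]_n) : R^o :=
  4^-1 * \sum_m invmx (gmat c x y) i m *
    (\sum_k 'D_(e_ k) (fun x' => 'D_(e_ m) (F2 c x') y) x * y 0 k
     - 'D_(e_ m) (F2 c ^~ y) x).

Definition berwald_coef c i j k l (x y : 'rV[R]_n) : R :=
  'D_(e_ j) ('D_(e_ k) ('D_(e_ l) (spray_coef c i x))) y.

(* Computed in the chart c around p; for a Finsler metric and y <> 0 the result
   does not depend on c. *)
Definition berwald_curv c p (y u v w : tangent A p) : tangent A p :=
  tvec A c p (\row_i \sum_j \sum_k \sum_l
    berwald_coef c i j k l (c p) (y c) * u c 0 j * v c 0 k * w c 0 l).

Definition berwald : Prop :=
  forall c p (y u v w : tangent A p), chart_at A p c -> y <> 0 ->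
    berwald_curv c y u v w = 0.

Definition isotropic_berwald : Prop :=
  exists2 Phi : M -> R, smooth_fun A Phi &
  forall c p (y u v w : tangent A p), chart_at A p c -> y <> 0 ->
    berwald_curv c y u v w =
    (Phi p * (F y)^-1) *:
      (angular_form y u v *: frakB y w + angular_form y v w *: frakB y u
       + angular_form y w u *: frakB y v
       + (2 * F y * cartan_torsion y u v w) *: ell y).

Definition isometry (phi : M -> M) : Prop :=
  diffeomorphism A phi /\ forall p (y : tangent A p), F (tmap phi y) = F y.

Definition homogeneous : Prop :=
  forall p q, exists2 phi, isometry phi & phi p = q.

Definition riemannian : Prop :=
  forall p, exists2 a : tangent A p -> tangent A p -> R,
    inner_product a & forall y, F y ^+ 2 = a y y.

Definition locally_minkowskian : Prop :=
  forall p, exists2 c, chart_at A p c &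
    forall x x' y, (c @` dom c) x -> (c @` dom c) x' -> Floc c x y = Floc c x' y.

Definition randers : Prop :=
  exists (a : forall p, tangent A p -> tangent A p -> R)
         (b : forall p, tangent A p -> R),
    [/\ riemannian_tensor a, one_form b
      & forall p (y : tangent A p), F y = Num.sqrt (a p y y) + b p y].

End Finsler.

(* Main.v *)
(* The isotropy condition says that the third y-derivatives of G^i and of
   Phi F y^i agree.  Hence, when n > 1, the spray is G^i = Phi F y^i + Q^i with Q
   quadratic in y, so that Q(-y) = Q(y); evenness of Q is read off three lines
   avoiding the origin of a plane.  Since F is constant along the spray
   y^k d/dx^k - 2 G^i d/dy^i, along y^k d/dx^k - 2 Q^i d/dy^i it satisfies a
   Funk-type equation: the indicatrix is translated with velocity proportional
   to Phi.

   The ratio F(x,-y)/F(x,y) attains its maximum on each tangent space, and by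
   homogeneity this maximum does not depend on x.  At a point (x,y) where it is
   attained, (x,y) is therefore a maximum over the whole slit tangent bundle, and
   all first derivatives of the ratio vanish there; but its derivative along
   y^k d/dx^k - 2 Q^i d/dy^i is a negative multiple of Phi(x).  So Phi = 0 and F
   is a Berwald metric.  When n = 1 the curvature vanishes because G^i is
   homogeneous of degree two. *)

From HB Require Import structures.
Require Import Defs.
From mathcomp Require Import all_boot all_order all_algebra.
From mathcomp Require Import all_classical all_reals all_analysis.
From mathcomp Require Import perm ring lra.

Set Implicit Arguments.
Unset Strict Implicit.
Unset Printing Implicit Defensive.

Import Order.TTheory GRing.Theory Num.Theory.
Import numFieldNormedType.Exports.
Local Open Scope classical_set_scope.
Local Open Scope ring_scope.

(** * Functions of class C^k *)

Section Calculus.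
Context {R : realType}.
Implicit Types V W : normedModType R.

Lemma near_open V (U : set V) (P : V -> Prop) x :
  open U -> U x -> (forall z, U z -> P z) -> \forall z \near x, P z.
Proof. by move=> oU Ux UP; apply: filterS UP _; exact: open_nbhs_nbhs. Qed.

(** The first-order expansion of [f] at [x] is also one of [g], and such an expansion determines the
    differential. This locality lets identities valid only on an open set be differentiated. *)
Lemma is_diff_near V W (f g df : V -> W) x :
  (\near x, f x = g x) -> is_diff x f df -> is_diff x g df.
Proof.
move=> fg Df; have dfx : differentiable f x by [].
have -> : df = 'd f x by rewrite diff_val.
have gE : g \o shift x = cst (g x) + 'd f x +o_ 0 id.
  apply/eqaddoP => e e0.
  have /eqaddoP/(_ e e0) fP := diff_locally dfx.
  rewrite -(nbhs_singleton fg).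
  have fg0 : \forall y \near 0, f (y + x) = g (y + x).
    by move: (fg); rewrite (near_shift 0 x) subr0.
  by apply: filterS2 fP fg0 => y; rewrite /= !fctE /= => + <-.
have gD := diff_unique (diff_continuous dfx) gE.
apply: DiffDef => //; apply/diff_locallyP; rewrite gD.
by split=> //; exact: diff_continuous.
Qed.

Lemma differentiable_near V W (f g : V -> W) x :
  (\near x, f x = g x) -> differentiable f x -> differentiable g x.
Proof. by move=> fg df; have := is_diff_near fg (differentiableP df). Qed.

Lemma diff_near V W (f g : V -> W) x :
  (\near x, f x = g x) -> differentiable f x -> 'd f x = 'd g x :> (V -> W).
Proof.
by move=> fg df; have := is_diff_near fg (differentiableP df) => ?; rewrite diff_val.
Qed.

Lemma Ck_eq V W k (U : set V) (f g : V -> W) :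
  open U -> (forall x, U x -> f x = g x) -> Ck k U f -> Ck k U g.
Proof.
move=> oU; elim: k f g => [|k IH] f g fg /=.
  move=> fc x Ux; have fgx := near_open oU Ux fg.
  rewrite /prop_for /continuous_at -(fg x Ux); apply: cvg_trans (fc _ Ux).
  exact: near_eq_cvg.
move=> [fd fD]; split=> [x Ux|v].
  exact: differentiable_near (near_open oU Ux fg) (fd _ Ux).
apply: IH (fD v) => x Ux; apply: near_eq_derive; exact: near_open fg.
Qed.

Lemma CkS V W k (U : set V) (f : V -> W) : Ck k.+1 U f -> Ck k U f.
Proof.
elim: k f => [|k IH] f /= [fd fD].
  by move=> x Ux; apply: differentiable_continuous; exact: fd.
by split=> // v; apply: IH; exact: fD.
Qed.

Lemma Ck_cst V W k (U : set V) (a : W) : Ck k U (cst a).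
Proof.
elim: k a => [|k IH] a /=; first by move=> x _; exact: cst_continuous.
split=> [x _|v]; first exact: differentiable_cst.
rewrite (_ : 'D_v _ = cst 0)//; by apply/funext => x; rewrite derive_cst.
Qed.

Lemma Ck_linear V W k (U : set V) (f : {linear V -> W}) :
  continuous f -> Ck k U f.
Proof.
move=> fc; case: k => [|k] /=; first by move=> x _; exact: fc.
split=> [x _|v]; first exact: linear_differentiable.
rewrite (_ : 'D_v _ = cst (f v)); first exact: Ck_cst.
apply/funext => x; rewrite deriveE ?diff_lin//; exact: linear_differentiable.
Qed.

Lemma CkD V W k (U : set V) (f g : V -> W) : open U ->
  Ck k U f -> Ck k U g -> Ck k U (f + g).
Proof.
move=> oU; elim: k f g => [|k IH] f g /=.
  by move=> fc gc x Ux; apply: continuousD; [exact: fc|exact: gc].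
move=> [fd fD] [gd gD]; split=> [x Ux|v].
  by apply: differentiableD; [exact: fd|exact: gd].
apply: Ck_eq (IH _ _ (fD v) (gD v)) => // x Ux.
by rewrite deriveD//; apply: diff_derivable; [exact: fd|exact: gd].
Qed.

Lemma CkM V k (U : set V) (f g : V -> R^o) : open U ->
  Ck k U f -> Ck k U g -> Ck k U (f * g : V -> R^o).
Proof.
move=> oU; elim: k f g => [|k IH] f g.
  by move=> /= fc gc x Ux; apply: continuousM; [exact: fc|exact: gc].
move=> fk gk; have [fd fD] := fk; have [gd gD] := gk; split=> [x Ux|v].
  by apply: differentiableM; [exact: fd|exact: gd].
have := CkD oU (IH _ _ (CkS fk) (gD v)) (IH _ _ (CkS gk) (fD v)).
apply: Ck_eq => // x Ux.
by rewrite (@deriveM _ _ f g)//; apply: diff_derivable; [exact: fd|exact: gd].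
Qed.

(** Since $(1/f)' = -(1/f)^2 f'$, class $C^k$ of $1/f$, known by induction, gives class
    $C^{k+1}$. *)
Lemma CkV V k (U : set V) (f : V -> R^o) : open U ->
  (forall x, U x -> f x != 0) -> Ck k U f ->
  Ck k U ((fun x => (f x)^-1) : V -> R^o).
Proof.
move=> oU f0; elim: k => [|k IH].
  by move=> /= fc x Ux; apply: continuousV; [exact: f0|exact: fc].
move=> fk; have [fd fD] := fk; split=> [x Ux|v].
  by apply: differentiableV; [exact: fd|exact: f0].
have fVk := IH (CkS fk).
have := CkM oU (Ck_cst k U (-1 : R^o)) (CkM oU (CkM oU fVk fVk) (fD v)).
apply: Ck_eq => // x Ux.
rewrite deriveV ?f0//; last by apply: diff_derivable; exact: fd.
by rewrite /GRing.scale /= /cst !fctE /= mulN1r expr2 invfM mulNr.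
Qed.

Lemma Ck_sum V k (U : set V) (I : Type) (r : seq I) (P : pred I)
    (f : I -> V -> R^o) : open U ->
  (forall i, Ck k U (f i)) -> Ck k U (\sum_(i <- r | P i) f i : V -> R^o).
Proof.
move=> oU fk; elim/big_rec: _ => [|i g _ gk]; first exact: (Ck_cst k U 0).
exact: CkD.
Qed.

Lemma Ck_prod V k (U : set V) (I : Type) (r : seq I) (P : pred I)
    (f : I -> V -> R^o) : open U ->
  (forall i, Ck k U (f i)) ->
  Ck k U ((fun x => \prod_(i <- r | P i) f i x) : V -> R^o).
Proof.
move=> oU fk; elim: r => [|i r IH].
  rewrite (_ : (fun _ => _) = cst 1); first exact: Ck_cst.
  by apply/funext => x; rewrite big_nil.
case Pi: (P i); last first.
  rewrite (_ : (fun _ => _) = (fun x => \prod_(i <- r | P i) f i x))//.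
  by apply/funext => x; rewrite big_cons Pi.
rewrite (_ : (fun _ => _) = (f i * (fun x => \prod_(i <- r | P i) f i x) : V -> R^o)).
  exact: CkM.
by apply/funext => x; rewrite big_cons Pi.
Qed.

Lemma Ck_det V k (U : set V) n (m : V -> 'M[R]_n) : open U ->
  (forall i j, Ck k U ((fun x => m x i j) : V -> R^o)) ->
  Ck k U ((fun x => \det (m x)) : V -> R^o).
Proof.
move=> oU mk; rewrite (_ : (fun _ => _) =
  (\sum_(s : 'S_n) ((cst ((-1) ^+ s) : V -> R^o)
     * (fun x => \prod_i m x i (s i))) : V -> R^o)).
  apply: Ck_sum => // s; apply: CkM => //; first exact: Ck_cst.
  by apply: (@Ck_prod _ _ _ _ _ _ (fun i x => m x i (s i))).
by apply/funext => x; rewrite fct_sumE.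
Qed.

(** Cramer's rule: each entry is a cofactor over the determinant. *)
Lemma Ck_invmx V k (U : set V) n (m : V -> 'M[R]_n) : open U ->
  (forall x, U x -> m x \in unitmx) ->
  (forall i j, Ck k U ((fun x => m x i j) : V -> R^o)) ->
  forall i j, Ck k U ((fun x => invmx (m x) i j) : V -> R^o).
Proof.
move=> oU mU mk i j.
have dk := Ck_det oU mk.
have d0 x : U x -> \det (m x) != 0 by move=> /mU; rewrite unitmxE unitfE.
have ck : Ck k U ((fun x => cofactor (m x) j i) : V -> R^o).
  rewrite /cofactor; apply: (CkM oU (Ck_cst k U ((-1) ^+ (j + i) : R^o))).
  apply: (@Ck_det _ _ _ _ (fun x => row' j (col' i (m x)))) => // a b.
  rewrite (_ : (fun _ => _) = (fun x => m x (lift j a) (lift i b)))//.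
  by apply/funext => x; rewrite !mxE.
apply: Ck_eq (CkM oU (CkV oU d0 dk) ck) => // x Ux.
by rewrite /invmx mU// !mxE.
Qed.

Lemma Ck_differentiable V W k (U : set V) (f : V -> W) x :
  U x -> Ck k.+1 U f -> differentiable f x.
Proof. by move=> Ux [fd _]; exact: fd. Qed.

(* Both sides are the limit of the same quotient, whether or not it exists. *)
Lemma derive_line V W (f : V -> W) a v (t : R) :
  'D_v f (t *: v + a) = 'D_1 (fun s : R => f (s *: v + a)) t.
Proof.
rewrite /derive; set g1 := fun h => h^-1 *: _; set g2 := fun h => h^-1 *: _.
suff -> : g1 = g2 by [].
by apply/funext => h; rewrite /g1 /g2 /= addrA -scalerDl [h%:A]mulr1.
Qed.

Lemma is_derive_line V W (f : V -> W) a v (t : R) :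
  differentiable f (t *: v + a) ->
  is_derive t 1 (fun s : R => f (s *: v + a)) ('D_v f (t *: v + a)).
Proof.
move=> df; split; last by rewrite -derive_line.
have : derivable f (t *: v + a) v by exact: diff_derivable.
rewrite /derivable.
set g1 := fun h => h^-1 *: _; set g2 := fun h => h^-1 *: _.
suff -> : g1 = g2 by [].
by apply/funext => h; rewrite /g1 /g2 /= addrA -scalerDl [h%:A]mulr1.
Qed.

Lemma near_line V (S : set V) (a v : V) : open S -> S a ->
  \forall t \near (0 : R), S (t *: v + a).
Proof.
move=> oS Sa; have : (fun t : R => t *: v + a) @ (0 : R) --> a.
  rewrite -[X in _ --> X]add0r -[X in _ --> X + _](scale0r v).
  apply: cvgD; last exact: cvg_cst.
  by apply: cvgZr_tmp; exact: cvg_id.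
by apply; exact: open_nbhs_nbhs.
Qed.

(** Fermat's rule for the restriction of [f] to the line through [a] in direction [v], on an
    interval that stays in [S]. *)
Lemma derive_local_max V (S : set V) (f : V -> R^o) (a v : V) :
  open S -> S a -> (forall z, S z -> differentiable f z) ->
  (forall z, S z -> f z <= f a) -> 'D_v f a = 0.
Proof.
move=> oS Sa df fmax; pose g (t : R) : R := f (t *: v + a).
have /nbhs_ballP[e /= e0 eS] := near_line v oS Sa.
have Sg t : t \in `](- e), e[%R -> S (t *: v + a).
  by rewrite in_itv /= => te; apply: eS; rewrite /ball /= sub0r normrN lter_norml.
have Dg t : t \in `](- e), e[%R -> is_derive t 1 g ('D_v f (t *: v + a)).
  by move=> /Sg /df; exact: is_derive_line.
have zeroI : 0 \in `](- e), e[%R by rewrite in_itv /= oppr_lt0 e0.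
have g0 : is_derive (0 : R) 1 g 0.
  apply: (@derive1_at_max _ g (- e) e) => //.
  - by rewrite ge0_cp// ltW.
  - by move=> t /Dg.
  - by move=> t /Sg /fmax; rewrite /g scale0r add0r.
have := Dg _ zeroI; rewrite scale0r add0r => Dg0.
by rewrite -(@derive_val _ _ _ _ _ _ _ Dg0) (@derive_val _ _ _ _ _ _ _ g0).
Qed.

Lemma derive_sumZ V W (f : V -> W) a (I : Type) (r : seq I) (c : I -> R) (v : I -> V) :
  differentiable f a ->
  'D_(\sum_(i <- r) c i *: v i) f a = \sum_(i <- r) c i *: 'D_(v i) f a.
Proof.
move=> df; rewrite deriveE// linear_sum; apply: eq_bigr => i _.
by rewrite linearZ deriveE.
Qed.

End Calculus.

(** * Functions that are quadratic along the lines of a plane *)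

Section Lines.
Context {R : realType}.

(** Subtracting the expected polynomial leaves a function with zero derivative, hence a constant;
    this is done first for [f1], then for [f0]. *)
Lemma is_derive_cst_quadratic (f0 f1 f2 : R -> R) :
  (forall t : R, is_derive t 1 f0 (f1 t)) ->
  (forall t : R, is_derive t 1 f1 (f2 t)) ->
  (forall t : R, is_derive t 1 f2 0) ->
  forall t, f0 t = f0 0 + f1 0 * t + 2^-1 * f2 0 * t ^+ 2.
Proof.
move=> D0 D1 D2 t; have f2E s : f2 s = f2 0 by exact: is_derive_0_is_cst.
have f1E s : f1 s = f1 0 + f2 0 * s.
  pose k (r : R) := f1 r - f2 0 * r.
  suff : k s = k 0 by rewrite /k mulr0 subr0 => <-; rewrite subrK.
  apply: is_derive_0_is_cst => r; apply: is_derive_eq.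
  by rewrite /GRing.scale /= f2E; ring.
pose k (r : R) := f0 r - f1 0 * r - 2^-1 * f2 0 * r ^+ 2.
have : k t = k 0.
  apply: is_derive_0_is_cst => r; apply: is_derive_eq.
  by rewrite /GRing.scale /= f1E; field.
rewrite /k; lra.
Qed.

(** For $t > 0$, homogeneity on $w + ty = t(t^{-1}w + y)$ reverses the coefficients of the quadratic
    on the line $y + tw$, so the leading coefficient of [h] on $w + ty$ is $h(y)$. Negative [t]
    compares the same line with $-y + tw$ and makes that coefficient $h(-y)$. *)
Lemma even_of_quadratic_lines {V : lmodType R} (h : V -> R) (y w : V) :
  (forall v (s : R), v != 0 -> 0 < s -> h (s *: v) = s ^+ 2 * h v) ->
  (forall t : R, t *: w + y != 0) -> (forall t : R, t *: y + w != 0) ->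
  (forall a b, (forall t : R, t *: b + a != 0) -> exists p q r,
     forall t : R, h (t *: b + a) = p + q * t + r * t ^+ 2) ->
  h (- y) = h y.
Proof.
move=> hom yw wy quad.
have Nyw (t : R) : t *: w - y != 0.
  by rewrite -oppr_eq0 opprB addrC -scaleNr yw.
have [p [q [r yE]]] := quad _ _ yw.
have [p' [q' [r' NyE]]] := quad _ _ Nyw.
have [a [b [c wE]]] := quad _ _ wy.
have := yE 0; rewrite scale0r add0r => ->.
have := NyE 0; rewrite scale0r add0r => ->.
have pos (t : R) : 0 < t -> a + b * t + c * t ^+ 2 = p * t ^+ 2 + q * t + r.
  move=> t0; rewrite -wE (_ : t *: y + w = t *: (t^-1 *: w + y)).
    by rewrite hom// yE; field; rewrite gt_eqF.
  by rewrite scalerDr scalerA divff ?gt_eqF// scale1r addrC.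
have neg (t : R) : 0 < t -> a - b * t + c * t ^+ 2 = p' * t ^+ 2 + q' * t + r'.
  move=> t0; rewrite -mulrN -sqrrN -wE.
  rewrite (_ : - t *: y + w = t *: (t^-1 *: w - y)).
    by rewrite hom// NyE; field; rewrite gt_eqF.
  by rewrite scalerBr scalerA divff ?gt_eqF// scale1r addrC scaleNr.
(* A quadratic polynomial is fixed by its values at three points, so these yield [c = p] and
   [c = p']. *)
have := pos 1; have := pos 2; have := pos 3.
have := neg 1; have := neg 2; have := neg 3.
rewrite ltr01 !ltr0n => /(_ isT) n3 /(_ isT) n2 /(_ isT) n1
  /(_ isT) p3 /(_ isT) p2 /(_ isT) p1; lra.
Qed.

(** Take for [w] a basis vector $e_j$ with $j \ne i$, where $y_i \ne 0$: coordinate [i] excludes the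
    origin from the first line, and forces $t = 0$ on the second, where coordinate [j] is then 1. *)
Lemma exists_independent n (y : 'rV[R]_n) : (1 < n)%N -> y != 0 ->
  exists w : 'rV[R]_n,
    (forall t : R, t *: w + y != 0) /\ (forall t : R, t *: y + w != 0).
Proof.
move=> n1 /rV0Pn[i yi].
have [j ji] : exists j : 'I_n, j != i.
  have [i0|i0] := eqVneq (i : nat) 0%N; last first.
    by exists (Ordinal (ltnW n1)); rewrite -val_eqE eq_sym.
  by exists (Ordinal n1); rewrite -val_eqE /= i0.
exists (delta_mx 0 j); split=> t; apply/eqP => /rowP.
  by move=> /(_ i); rewrite !mxE /= eq_sym (negPf ji) mulr0 add0r => /eqP; apply/negP.
move=> eq0; have := eq0 i; have := eq0 j.
rewrite !mxE /= eqxx eq_sym (negPf ji) /= addr0 => tj /eqP.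
rewrite mulf_eq0 (negPf yi) orbF => /eqP t0.
by move: tj; rewrite t0 mul0r add0r => /eqP; rewrite oner_eq0.
Qed.

End Lines.

(** * Calculus on the slit tangent bundle of an open set *)

(* Locked: unfolding to limits makes unification of iterated derivatives blow up. *)
HB.lock Definition dx (R : realType) n (v : 'rV[R]_n) (f : 'rV[R]_n * 'rV[R]_n -> R^o) :
  'rV[R]_n * 'rV[R]_n -> R^o := 'D_((v, 0) : 'rV[R]_n * 'rV[R]_n) f.
HB.lock Definition dy (R : realType) n (v : 'rV[R]_n) (f : 'rV[R]_n * 'rV[R]_n -> R^o) :
  'rV[R]_n * 'rV[R]_n -> R^o := 'D_((0, v) : 'rV[R]_n * 'rV[R]_n) f.

Section SlitBundle.
Context {R : realType} {n : nat}.
Local Notation X := 'rV[R]_n.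
Local Notation Z := (X * X)%type.
Implicit Types (f g : Z -> R^o) (z : Z) (u v w : X) (U : set X).

Definition slit U : set Z := [set z | U z.1 /\ z.2 <> 0].
Definition scaly (s : R) z : Z := (z.1, s *: z.2).
Definition homy U k f := forall s z, 0 < s -> slit U z -> f (scaly s z) = s ^+ k * f z.

Lemma open_slit U : open U -> open (slit U).
Proof.
move=> oU; rewrite (_ : slit U = (fst @^-1` U) `&` (snd @^-1` (~` [set 0])))//.
apply: openI.
  by apply: open_comp oU => z _; exact: cvg_fst.
apply: open_comp; first by move=> z _; exact: cvg_snd.
rewrite openC; apply: accessible_closed_set1.
exact/hausdorff_accessible/norm_hausdorff.
Qed.

Lemma slit_scaly U s z : 0 < s -> slit U z -> slit U (scaly s z).
Proof.
move=> s0 [Uz z0]; split=> //= /eqP; rewrite scaler_eq0 gt_eqF//= => /eqP.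
exact: z0.
Qed.

Lemma smooth_dx U v f : smooth_on (slit U) f -> smooth_on (slit U) (dx v f).
Proof. by move=> fs k; have [_ fD] := fs k.+1; rewrite dx.unlock; exact: fD. Qed.

Lemma smooth_dy U v f : smooth_on (slit U) f -> smooth_on (slit U) (dy v f).
Proof. by move=> fs k; have [_ fD] := fs k.+1; rewrite dy.unlock; exact: fD. Qed.

Lemma smooth_diff U f z : smooth_on (slit U) f -> slit U z -> differentiable f z.
Proof. by move=> fs Uz; exact: Ck_differentiable (fs 1%N). Qed.

Lemma smoothM U f g : open U -> smooth_on (slit U) f -> smooth_on (slit U) g ->
  smooth_on (slit U) (f * g : Z -> R^o).
Proof. by move=> oU fs gs k; apply: CkM => //; exact: open_slit. Qed.

Lemma smooth_coord U i : smooth_on (slit U) (fun z => z.2 0 i : R^o).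
Proof.
pose c z : R^o := z.2 0 i.
have lin : linear c by move=> a x y; rewrite /c /= !mxE.
pose cM := GRing.isLinear.Build _ _ _ _ _ lin.
pose cL : {linear Z -> R^o} := HB.pack c cM.
move=> k; rewrite (_ : (fun _ => _) = cL)//; apply: Ck_linear => z.
apply: (@continuous_comp _ _ _ snd (fun y : X => y 0 i : R^o)).
  exact: cvg_snd.
exact: coord_continuous.
Qed.

Lemma eq_dy U f g v z : open U -> slit U z -> (forall z, slit U z -> f z = g z) ->
  dy v f z = dy v g z.
Proof.
move=> oU Uz fg; rewrite dy.unlock; apply: near_eq_derive.
exact: near_open (open_slit oU) Uz fg.
Qed.

Lemma pair_suml (I : Type) (r : seq I) (F : I -> X) :
  (\sum_(i <- r) F i, 0) = \sum_(i <- r) (F i, 0) :> Z.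
Proof. by elim/big_rec2: _ => // i a b _ <-; congr (_, _); rewrite /= addr0. Qed.

Lemma pair_sumr (I : Type) (r : seq I) (F : I -> X) :
  (0, \sum_(i <- r) F i) = \sum_(i <- r) (0, F i) :> Z.
Proof. by elim/big_rec2: _ => // i a b _ <-; congr (_, _); rewrite /= addr0. Qed.

Lemma dx_sum f v z : differentiable f z ->
  dx v f z = \sum_i v 0 i * dx (delta_mx 0 i) f z.
Proof.
move=> df; rewrite dx.unlock {1}(row_sum_delta v) pair_suml.
rewrite (eq_bigr (fun i => v 0 i *: ((delta_mx 0 i, 0) : Z))); last first.
  by move=> i _; congr (_, _); rewrite /= scaler0.
exact: derive_sumZ.
Qed.

Lemma dy_sum f v z : differentiable f z ->
  dy v f z = \sum_i v 0 i * dy (delta_mx 0 i) f z.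
Proof.
move=> df; rewrite dy.unlock {1}(row_sum_delta v) pair_sumr.
rewrite (eq_bigr (fun i => v 0 i *: ((0, delta_mx 0 i) : Z))); last first.
  by move=> i _; congr (_, _); rewrite /= scaler0.
exact: derive_sumZ.
Qed.

Lemma dxE f v x y : dx v f (x, y) = 'D_v (fun x' => f (x', y) : R^o) x.
Proof.
rewrite dx.unlock /derive; set g1 := fun h => h^-1 *: _; set g2 := fun h => h^-1 *: _.
suff -> : g1 = g2 by [].
apply/funext => h; rewrite /g1 /g2 /=; congr (_ *: (f (_, _) - _)).
by rewrite /= scaler0 add0r.
Qed.

Lemma dyE f v x y : dy v f (x, y) = 'D_v (fun y' => f (x, y') : R^o) y.
Proof.
rewrite dy.unlock /derive; set g1 := fun h => h^-1 *: _; set g2 := fun h => h^-1 *: _.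
suff -> : g1 = g2 by [].
apply/funext => h; rewrite /g1 /g2 /=; congr (_ *: (f (_, _) - _)).
by rewrite /= scaler0 add0r.
Qed.

Lemma is_derive_dy f x u v (t : R) : differentiable f (x, t *: v + u) ->
  is_derive t 1 (fun s : R => f (x, s *: v + u)) (dy v f (x, t *: v + u)).
Proof.
have lineE (s : R) : (x, s *: v + u) = s *: ((0, v) : Z) + (x, u).
  by congr (_, _); rewrite /= ?scaler0 ?add0r.
move=> df; rewrite dy.unlock lineE.
rewrite (_ : (fun _ => _) = (fun s : R => f (s *: ((0, v) : Z) + (x, u)))).
  by apply: is_derive_line; rewrite -lineE.
by apply/funext => s; rewrite lineE.
Qed.

Lemma derive_scaly f (s : R) (v z : Z) :
  'D_(scaly s v) f (scaly s z) = 'D_v (f \o scaly s : Z -> R^o) z.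
Proof.
rewrite /derive; set g1 := fun h => h^-1 *: _; set g2 := fun h => h^-1 *: _.
suff -> : g1 = g2 by [].
apply/funext => h; rewrite /g1 /g2 /=; congr (_ *: (f (_, _) - _)).
by rewrite /= scalerDr !scalerA mulrC.
Qed.

Lemma homy_derive U f k s (v z : Z) : open U -> smooth_on (slit U) f -> homy U k f ->
  0 < s -> slit U z -> 'D_(scaly s v) f (scaly s z) = s ^+ k * 'D_v f z.
Proof.
move=> oU fs fh s0 Uz; rewrite derive_scaly.
rewrite (@near_eq_derive _ _ _ _ (s ^+ k *: f)).
  by rewrite deriveZ//; apply: diff_derivable; exact: smooth_diff fs Uz.
by apply: near_open (open_slit oU) Uz _ => z' Uz'; rewrite /= fh.
Qed.

Lemma homy_dx U f k v : open U -> smooth_on (slit U) f -> homy U k f ->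
  homy U k (dx v f).
Proof.
move=> oU fs fh s z s0 Uz; rewrite dx.unlock -(homy_derive _ oU fs fh s0 Uz).
by rewrite /scaly /= scaler0.
Qed.

(** The vertical vector $(0,v)$ is itself multiplied by [s] under [scaly s], and cancelling this
    factor lowers the degree by one; horizontal vectors are fixed, so [dx] keeps the degree. *)
Lemma homy_dy U f k v : open U -> smooth_on (slit U) f -> homy U k.+1 f ->
  homy U k (dy v f).
Proof.
move=> oU fs fh s z s0 Uz.
have := homy_derive (0, v) oU fs fh s0 Uz.
rewrite (_ : scaly s (0, v) = s *: ((0, v) : Z)); last first.
  by congr (_, _); rewrite /= scaler0.
have dfs : differentiable f (scaly s z) by apply: smooth_diff fs _; exact: slit_scaly.
rewrite dy.unlock deriveE// linearZ -deriveE// exprS -mulrA => /mulfI; apply.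
by rewrite gt_eqF.
Qed.

(** Differentiate $f(x,(1+s)y) = (1+s)^k f(x,y)$ at $s = 0$. *)
Lemma euler U f k z : open U -> smooth_on (slit U) f -> homy U k f -> slit U z ->
  dy z.2 f z = k%:R * f z.
Proof.
move=> oU fs fh Uz; case: z Uz => x y Uz /=.
have df : differentiable f (x, 0 *: y + y).
  by rewrite scale0r add0r; exact: smooth_diff fs Uz.
have := is_derive_dy df; rewrite [in dy _ _ _]scale0r add0r => D.
suff D' : is_derive (0 : R) 1 (fun s : R => f (x, s *: y + y) : R^o) (k%:R * f (x, y)).
  by rewrite -[LHS](@derive_val _ _ _ _ _ _ _ D) (@derive_val _ _ _ _ _ _ _ D').
apply: (@near_eq_is_derive _ _ _ (fun s : R => (s + 1) ^+ k * (f (x, y) : R))).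
  (* Homogeneity concerns positive factors only, hence the restriction to $s > -1$. *)
  have : \forall s \near (0 : R), -1 < s by apply: lt_nbhsr; rewrite ltrN10.
  apply: filterS => s s1; rewrite -(fh (s + 1) (x, y))//.
    by rewrite /scaly /= scalerDl scale1r.
  by rewrite -ltrBlDr sub0r.
case: k {fh} => [|k].
  by rewrite mul0r; under eq_fun do rewrite expr0 mul1r; exact: is_derive_cst.
set c : R := f (x, y).
rewrite (_ : (fun _ => _) = ((id + cst 1) ^+ k.+1 : R -> R) * cst c); last first.
  by apply/funext => s; rewrite !fctE.
apply: is_derive_eq; rewrite /GRing.scale /= !fctE /=.
by rewrite !(add0r, expr1n, mulr1, addr0, mulr0) mulrC.
Qed.

Lemma dyM U f g v z : smooth_on (slit U) f -> smooth_on (slit U) g ->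
  slit U z -> dy v (f * g : Z -> R^o) z = f z * dy v g z + g z * dy v f z.
Proof.
by move=> fs gs Uz; rewrite dy.unlock (@deriveM _ _ f g)//;
  apply: diff_derivable; [exact: smooth_diff fs Uz|exact: smooth_diff gs Uz].
Qed.

Lemma dyD U f g v z : smooth_on (slit U) f -> smooth_on (slit U) g ->
  slit U z -> dy v (f + g : Z -> R^o) z = dy v f z + dy v g z.
Proof.
by move=> fs gs Uz; rewrite dy.unlock deriveD//;
  apply: diff_derivable; [exact: smooth_diff fs Uz|exact: smooth_diff gs Uz].
Qed.

Lemma dyZ U f (a : R) v z : smooth_on (slit U) f -> slit U z ->
  dy v (a *: f) z = a * dy v f z.
Proof.
by move=> fs Uz; rewrite dy.unlock deriveZ//; apply: diff_derivable; exact: smooth_diff fs Uz.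
Qed.

Lemma smoothD U f g : open U -> smooth_on (slit U) f -> smooth_on (slit U) g ->
  smooth_on (slit U) (f + g : Z -> R^o).
Proof. by move=> oU fs gs k; apply: CkD => //; exact: open_slit. Qed.

Lemma dx_scale (a : R) v f z : differentiable f z -> dx (a *: v) f z = a * dx v f z.
Proof.
move=> df; rewrite dx.unlock [X in 'D_X _ _](_ : _ = a *: ((v, 0) : Z)); last first.
  by congr (_, _); rewrite /= scaler0.
by rewrite !deriveE// linearZ.
Qed.

Lemma dy_linear (a : R) u v f z : differentiable f z ->
  dy (u + a *: v) f z = dy u f z + a * dy v f z.
Proof.
move=> df; rewrite dy.unlock [X in 'D_X _ _](_ : _ = ((0, u) : Z) + a *: ((0, v) : Z)).
  by rewrite !deriveE// linearD linearZ.
by congr (_, _); rewrite /= scaler0 addr0.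
Qed.

Lemma dy_scale (a : R) v f z : differentiable f z -> dy (a *: v) f z = a * dy v f z.
Proof.
move=> df; rewrite dy.unlock [X in 'D_X _ _](_ : _ = a *: ((0, v) : Z)); last first.
  by congr (_, _); rewrite /= scaler0.
by rewrite !deriveE// linearZ.
Qed.

Lemma derive_dxdy u v f z : differentiable f z ->
  'D_((u, v) : Z) f z = dx u f z + dy v f z.
Proof.
move=> df; rewrite dx.unlock dy.unlock [X in 'D_X _ _](_ : _ = ((u, 0) : Z) + ((0, v) : Z)).
  by rewrite !deriveE// linearD.
by congr (_, _); rewrite /= ?add0r ?addr0.
Qed.

Lemma derive_lincomb U (h : 'I_n -> Z -> R^o) (a : 'I_n -> R) (t z : Z) :
  (forall j, smooth_on (slit U) (h j)) -> slit U z ->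
  'D_t (fun z => \sum_j a j * h j z : R^o) z = \sum_j a j * 'D_t (h j) z.
Proof.
move=> hs Uz; have hd j : derivable (h j) z t.
  by apply: diff_derivable; exact: smooth_diff (hs j) Uz.
rewrite (_ : (fun _ => _) = \sum_j a j *: h j).
  rewrite derive_sum; first by apply: eq_bigr => j _; rewrite deriveZ.
  by move=> j; exact: derivableZ.
by apply/funext => z'; rewrite fct_sumE.
Qed.

Lemma dx_lincomb U (h : 'I_n -> Z -> R^o) (a : 'I_n -> R) v z :
  (forall j, smooth_on (slit U) (h j)) -> slit U z ->
  dx v (fun z => \sum_j a j * h j z : R^o) z = \sum_j a j * dx v (h j) z.
Proof. by rewrite dx.unlock; exact: derive_lincomb. Qed.

Lemma dy_lincomb U (h : 'I_n -> Z -> R^o) (a : 'I_n -> R) v z :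
  (forall j, smooth_on (slit U) (h j)) -> slit U z ->
  dy v (fun z => \sum_j a j * h j z : R^o) z = \sum_j a j * dy v (h j) z.
Proof. by rewrite dy.unlock; exact: derive_lincomb. Qed.

End SlitBundle.

(** * Finsler metrics in coordinates *)

Section LocalFinsler.
Context {R : realType} {n : nat}.
Local Notation X := 'rV[R]_n.
Local Notation Z := (X * X)%type.
Implicit Types (f g : Z -> R^o) (z : Z) (u v w y : X).

Definition energy (L : Z -> R^o) : Z -> R^o := L * L.

(** The chart expression of a Finsler metric; [dy u (dy u (energy L))] is twice
    $\mathbf{g}_y(u,u)$. *)
Record local_finsler (U : set X) (L : Z -> R^o) : Prop := LocalFinslerDef {
  lf_open : open U;
  lf_smooth : smooth_on (slit U) L;
  lf_homy : homy U 1 L;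
  lf_ge0 : forall z, 0 <= L z;
  lf_pos : forall z u, slit U z -> u <> 0 -> 0 < dy u (dy u (energy L)) z }.

Lemma dy2_sum (U : set X) f u v z : open U -> smooth_on (slit U) f -> slit U z ->
  dy u (dy v f) z = \sum_j v 0 j * dy u (dy (delta_mx 0 j) f) z.
Proof.
move=> oU fs Uz; rewrite -(dy_lincomb _ _ (fun j => smooth_dy _ fs) Uz).
apply: (eq_dy _ oU Uz) => z' Uz'; apply: dy_sum; exact: smooth_diff fs Uz'.
Qed.

(** Linearity in each direction in turn; it converts the coordinate contraction of $B^i_{\ jkl}$
    into a third directional derivative of $G^i$. *)
Lemma dy3_sum (U : set X) f u v w z : open U -> smooth_on (slit U) f -> slit U z ->
  dy u (dy v (dy w f)) z = \sum_i \sum_j \sum_k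
    dy (delta_mx 0 i) (dy (delta_mx 0 j) (dy (delta_mx 0 k) f)) z
      * u 0 i * v 0 j * w 0 k.
Proof.
move=> oU fs Uz; rewrite (dy_sum u (smooth_diff (smooth_dy v (smooth_dy w fs)) Uz)).
apply: eq_bigr => i _.
rewrite [X in _ * X](dy2_sum _ v oU (smooth_dy w fs) Uz) mulr_sumr; apply: eq_bigr => j _.
have dE : dy (delta_mx 0 i) (dy (delta_mx 0 j) (dy w f)) z =
    \sum_k w 0 k * dy (delta_mx 0 i) (dy (delta_mx 0 j) (dy (delta_mx 0 k) f)) z.
  rewrite -(dy_lincomb _ _ (fun k => smooth_dy _ (smooth_dy _ fs)) Uz).
  by apply: (eq_dy _ oU Uz) => z' Uz'; exact: (dy2_sum _ _ oU fs Uz').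
rewrite [X in _ * (_ * X)]dE !mulr_sumr; apply: eq_bigr => k _; ring.
Qed.

Variables (U : set X) (L : Z -> R^o).
Hypothesis LF : local_finsler U L.

Let oU := lf_open LF.
Let Ls := lf_smooth LF.
Let Lh := lf_homy LF.

Lemma smooth_energy : smooth_on (slit U) (energy L).
Proof. exact: smoothM. Qed.

Lemma homy_energy : homy U 2 (energy L).
Proof.
by move=> s z s0 Uz; rewrite /energy !fctE Lh// expr1 expr2 mulrACA.
Qed.

Let Es := smooth_energy.
Let Eh := homy_energy.

(** Two uses of Euler's identity show that the second derivative of the energy in direction [y] at
    [y] is twice the energy, and it is positive by definiteness. *)
Lemma energy_gt0 z : slit U z -> 0 < energy L z.
Proof.
move=> Uz; have [_ z0] := Uz; have := lf_pos LF Uz z0.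
rewrite (euler oU (smooth_dy _ Es) (homy_dy _ oU Es Eh) Uz).
by rewrite (euler oU Es Eh Uz) mul1r pmulr_rgt0.
Qed.

Lemma L_gt0 z : slit U z -> 0 < L z.
Proof.
move=> /energy_gt0; have := lf_ge0 LF z; rewrite le_eqVlt => /orP[/eqP L0|//].
by rewrite /energy !fctE -L0 mul0r ltxx.
Qed.

Definition hess z : 'M[R]_n :=
  \matrix_(i, j) (2^-1 * dy (delta_mx 0 i) (dy (delta_mx 0 j) (energy L)) z).

(** A nonzero vector in the kernel would be null for the positive definite form $\mathbf{g}_y$. *)
Lemma hess_unit z : slit U z -> hess z \in unitmx.
Proof.
move=> Uz; rewrite unitmxE unitfE; apply/det0P => -[v /eqP v0 vA].
have := lf_pos LF Uz v0; suff -> : dy v (dy v (energy L)) z = 2 * (v *m hess z *m v^T) 0 0.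
  by rewrite vA mul0mx mxE mulr0 ltxx.
rewrite (dy2_sum _ _ oU Es Uz) mxE mulr_sumr; apply: eq_bigr => j _.
rewrite !mxE (dy_sum v (smooth_diff (smooth_dy _ Es) Uz)).
rewrite mulrC mulr_suml mulr_suml mulr_sumr; apply: eq_bigr => i _.
by rewrite !mxE; field.
Qed.

(** The covector $4 g_{mi} G^i$. *)
Definition spray_rhs m : Z -> R^o := fun z =>
  \sum_k dx (delta_mx 0 k) (dy (delta_mx 0 m) (energy L)) z * z.2 0 k
  - dx (delta_mx 0 m) (energy L) z.

Definition spray i : Z -> R^o := fun z =>
  4^-1 * \sum_m invmx (hess z) i m * spray_rhs m z.

Lemma smooth_spray i : smooth_on (slit U) (spray i).
Proof.
have oS := open_slit oU; move=> k.
have rk m : Ck k (slit U) (spray_rhs m).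
  rewrite (_ : spray_rhs m = (\sum_k (dx (delta_mx 0 k) (dy (delta_mx 0 m) (energy L))
      * (fun z => z.2 0 k : R^o))) + cst (-1 : R^o) * dx (delta_mx 0 m) (energy L)).
    apply: CkD => //.
      apply: Ck_sum => // l; apply: CkM => //; last exact: smooth_coord.
      exact: smooth_dx (smooth_dy _ Es) k.
    by apply: CkM => //; [exact: Ck_cst|exact: smooth_dx Es k].
  by apply/funext => z; rewrite /spray_rhs !fctE fct_sumE /cst mulN1r.
have hk a b : Ck k (slit U) (fun z => hess z a b : R^o).
  rewrite (_ : (fun _ => _) = cst (2^-1 : R^o) *
      dy (delta_mx 0 a) (dy (delta_mx 0 b) (energy L))).
    apply: CkM => //; first exact: Ck_cst.
    exact: smooth_dy (smooth_dy _ Es) k.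
  by apply/funext => z; rewrite mxE.
rewrite (_ : spray i = cst (4^-1 : R^o) *
    (\sum_m ((fun z => invmx (hess z) i m : R^o) * spray_rhs m))).
  apply: CkM => //; first exact: Ck_cst.
  apply: Ck_sum => // m; apply: CkM => //.
  exact: (Ck_invmx oS hess_unit hk).
by apply/funext => z; rewrite /spray fctE fct_sumE.
Qed.

(** The fundamental tensor has degree 0 in [y], and both terms of [spray_rhs] have degree 2. *)
Lemma homy_spray i : homy U 2 (spray i).
Proof.
move=> s z s0 Uz.
have hE : hess (scaly s z) = hess z.
  apply/matrixP => a b; rewrite [LHS]mxE [RHS]mxE; congr (_ * _).
  have h0 := homy_dy (delta_mx 0 a) oU (smooth_dy _ Es) (homy_dy (delta_mx 0 b) oU Es Eh).
  by rewrite [LHS](h0 s z s0 Uz) mul1r.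
rewrite /spray hE mulrCA; congr (_ * _); rewrite mulr_sumr; apply: eq_bigr => m _.
rewrite mulrCA; congr (_ * _); rewrite /spray_rhs mulrBr; congr (_ - _).
  rewrite mulr_sumr; apply: eq_bigr => k _.
  have h1 := homy_dx (delta_mx 0 k) oU (smooth_dy _ Es) (homy_dy (delta_mx 0 m) oU Es Eh).
  move: (h1 s z s0 Uz); set a := dx _ _ (scaly s z); set b := dx _ _ z => ->.
  by rewrite mxE; ring.
exact: (homy_dx _ oU Es Eh s0 Uz).
Qed.

(* The spray preserves the energy: [y^k dE/dx^k = 2 G^i dE/dy^i]. *)
Lemma spray_energy x y : slit U (x, y) ->
  dx y (energy L) (x, y) = 2 * dy (\row_i spray i (x, y)) (energy L) (x, y).
Proof.
set z := (x, y) => Uz; have dE := smooth_diff Es Uz.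
(* Euler's identity for the 1-homogeneous function $\partial E/\partial y^i$, with $E = L^2$. *)
have gradE i : dy (delta_mx 0 i) (energy L) z = 2 * (y *m hess z) 0 i.
  have := @euler _ _ U (dy (delta_mx 0 i) (energy L)) 1 z oU (smooth_dy _ Es)
    (homy_dy _ oU Es Eh) Uz; rewrite mul1r => <-.
  rewrite (dy_sum _ (smooth_diff (smooth_dy _ Es) Uz)) mxE mulr_sumr.
  by apply: eq_bigr => j _; rewrite !mxE /=; field.
(* Contracted with a frozen [y], the first term of [spray_rhs] is the derivative along $y$ in $x$ of
   $y^m \partial E/\partial y^m = 2E$, and the second term removes half of it. *)
have yT : \sum_m y 0 m * spray_rhs m z = dx y (energy L) z.
  have -> : \sum_m y 0 m * spray_rhs m z =
      \sum_m y 0 m * dx y (dy (delta_mx 0 m) (energy L)) z - dx y (energy L) z.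
    rewrite (dx_sum y dE) -sumrB; apply: eq_bigr => m _.
    rewrite -mulrBr; congr (_ * (_ - _)).
    rewrite (dx_sum y (smooth_diff (smooth_dy _ Es) Uz)).
    by apply: eq_bigr => k _; rewrite mulrC.
  rewrite -(dx_lincomb _ _ (fun m => smooth_dy _ Es) Uz).
  suff -> : dx y (fun z' => \sum_m y 0 m * dy (delta_mx 0 m) (energy L) z' : R^o) z
    = 2 * dx y (energy L) z by ring.
  rewrite /z !dxE.
  rewrite (@near_eq_derive _ _ _ _ (2 *: (fun x' => energy L (x', y) : R^o))).
    have dEx : derivable ((energy L) \o (fun x' => (x', y))) x y.
      apply: diff_derivable; apply: differentiable_comp; last exact: dE.
      by apply: differentiable_pair => //; exact: differentiable_cst.
    by rewrite deriveZ.
  apply: near_open oU (Uz.1) _ => x' Ux'.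
  have Uz' : slit U (x', y) by split=> //; exact: Uz.2.
  rewrite -(dy_sum y (smooth_diff Es Uz')).
  exact: (@euler _ _ U (energy L) 2 (x', y) oU Es Eh Uz').
have -> : dy (\row_i spray i z) (energy L) z =
    \sum_i spray i z * (2 * (y *m hess z) 0 i).
  by rewrite (dy_sum _ dE); apply: eq_bigr => i _; rewrite mxE gradE.
rewrite -yT.
(* Inserting the product of [hess z] and its inverse makes the spray coefficients appear. *)
transitivity (\sum_m (y *m hess z *m invmx (hess z)) 0 m * spray_rhs m z).
  by rewrite mulmxK// hess_unit.
under eq_bigr do rewrite mxE mulr_suml.
rewrite exchange_big mulr_sumr; apply: eq_bigr => i _ /=.
rewrite /spray mulr_sumr mulr_suml mulr_sumr; by apply: eq_bigr => m _; field.
Qed.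

End LocalFinsler.

(** * The isotropy condition in a chart *)

Section LocalIsotropic.
Context {R : realType} {n : nat}.
Local Notation X := 'rV[R]_n.
Local Notation Z := (X * X)%type.
Implicit Types (f g : Z -> R^o) (z : Z) (u v w x y : X).

Variables (U : set X) (L : Z -> R^o).
Hypothesis LF : local_finsler U L.
Let oU := lf_open LF.
Let Ls := lf_smooth LF.
Let Lh := lf_homy LF.
Let Es := smooth_energy LF.
Let Eh := homy_energy LF.
Let Gs := smooth_spray LF.

(** Together with the next two lemmas, this expresses $\mathbf{g}$, $\mathbf{h}$ and $\mathbf{C}$
    through derivatives of $F$, in terms of which the isotropy condition is an equality of third
    derivatives. *)
Lemma dy_energy w z : slit U z -> dy w (energy L) z = 2 * (L z * dy w L z).
Proof. by move=> Uz; rewrite (dyM _ Ls Ls Uz); ring. Qed.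

Lemma dy2_energy w z : slit U z ->
  dy w (dy w (energy L)) z = 2 * (dy w L z ^+ 2 + L z * dy w (dy w L) z).
Proof.
move=> Uz; have Lw := smooth_dy w Ls.
transitivity (dy w (2 *: (L * dy w L : Z -> R^o)) z).
  by apply: (eq_dy _ oU Uz) => z' Uz'; rewrite dy_energy.
rewrite [LHS](dyZ _ _ (smoothM oU Ls Lw) Uz); congr (_ * _).
by rewrite [LHS](dyM _ Ls Lw Uz) addrC expr2.
Qed.

Lemma dy3_energy w z : slit U z ->
  dy w (dy w (dy w (energy L))) z =
  2 * (3 * (dy w L z * dy w (dy w L) z) + L z * dy w (dy w (dy w L)) z).
Proof.
move=> Uz; have Lw := smooth_dy w Ls; have Lww := smooth_dy w Lw.
have P1 := smoothM oU Lw Lw; have P2 := smoothM oU Ls Lww.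
transitivity (dy w (2 *: ((dy w L * dy w L) + (L * dy w (dy w L)) : Z -> R^o)) z).
  by apply: (eq_dy _ oU Uz) => z' Uz'; rewrite [LHS]dy2_energy.
rewrite [LHS](dyZ _ _ (smoothD oU P1 P2) Uz); congr (_ * _).
rewrite [LHS](dyD _ P1 P2 Uz) [X in X + _](dyM _ Lw Lw Uz) [X in _ + X](dyM _ Ls Lww Uz).
ring.
Qed.

(* With [y] frozen, [dy y E] at [y + s w] is [2 E - s dy w E] by Euler's identity. *)
Lemma dy_dy_energy w x y : slit U (x, y) ->
  dy w (dy y (energy L)) (x, y) = dy w (energy L) (x, y).
Proof.
move=> Uz; have Ew := smooth_dy w Es; have Ey := smooth_dy y Es.
have dfE f : smooth_on (slit U) f ->
    is_derive (0 : R) 1 (fun s : R => f (x, s *: w + y)) (dy w f (x, y)).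
  move=> fs; have := @is_derive_dy _ _ f x y w 0; rewrite scale0r add0r; apply.
  exact: smooth_diff fs Uz.
have D1 := dfE _ Ey; have D2 := dfE _ Es; have D3 := dfE _ Ew.
pose k (s : R) : R := 2 * energy L (x, s *: w + y) - s * dy w (energy L) (x, s *: w + y).
have Dk : is_derive (0 : R) 1 k (dy w (energy L) (x, y)).
  apply: is_derive_eq; rewrite !scale0r !add0r /GRing.scale /=; ring.
suff D : is_derive (0 : R) 1 k (dy w (dy y (energy L)) (x, y)).
  by rewrite -(@derive_val _ _ _ _ _ _ _ D) (@derive_val _ _ _ _ _ _ _ Dk).
apply: near_eq_is_derive D1.
have := near_line (0, w) (open_slit oU) Uz; apply: filterS => s.
rewrite (_ : _ + _ = (x, s *: w + y)); last by congr (_, _); rewrite /= scaler0 add0r.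
move=> Us; rewrite /k.
have := euler oU Es Eh Us; rewrite /= => <-.
rewrite [X in dy X _ _](_ : y = (s *: w + y) + (- s) *: w); last first.
  by rewrite scaleNr addrAC addrN add0r.
rewrite (dy_linear _ _ _ (smooth_diff Es Us)); ring.
Qed.

(** Since the third derivative of $L y^i$ along $w$ is $3 L_{ww} w^i + L_{www} y^i$, the hypothesis
    makes $G^i - \Phi L y^i$ quadratic on every line that misses the origin. It is also
    2-homogeneous, hence even; the plus sign on the left comes from the factor $(-y)^i$. *)
Lemma spray_even (Phi : R) x : (1 < n)%N -> U x ->
  (forall i w y, y <> 0 -> dy w (dy w (dy w (spray L i))) (x, y) =
     Phi * (3 * dy w (dy w L) (x, y) * w 0 i
            + dy w (dy w (dy w L)) (x, y) * y 0 i)) ->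
  forall i y, y <> 0 ->
    spray L i (x, - y) + Phi * (L (x, - y) * y 0 i)
    = spray L i (x, y) - Phi * (L (x, y) * y 0 i).
Proof.
move=> n1 Ux iso i y /eqP y0.
have [w [yw wy]] := exists_independent n1 y0.
pose h (v : X) : R := spray L i (x, v) - Phi * (L (x, v) * v 0 i).
suff : h (- y) = h y by rewrite /h mxE mulrN mulrN opprK.
apply: (even_of_quadratic_lines (w := w)) => // [v s /eqP v0 s0|a b ab0].
  have Uv : slit U (x, v) by [].
  rewrite /h mxE -[(x, s *: v)]/(scaly s (x, v)) (homy_spray LF _ s0 Uv) Lh// expr1; ring.
have Uab (t : R) : slit U (x, t *: b + a) by split=> //=; exact/eqP.
have Lb := smooth_dy b Ls; have Lbb := smooth_dy b Lb.
have Gb := smooth_dy b (Gs i); have Gbb := smooth_dy b Gb.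
have dfE f (t : R) : smooth_on (slit U) f ->
    is_derive t 1 (fun s : R => f (x, s *: b + a)) (dy b f (x, t *: b + a)).
  by move=> fs; apply: is_derive_dy; exact: smooth_diff fs (Uab t).
have L0 t := dfE _ t Ls; have L1 t := dfE _ t Lb; have L2 t := dfE _ t Lbb.
have G0 t := dfE _ t (Gs i); have G1 t := dfE _ t Gb; have G2 t := dfE _ t Gbb.
pose c (t : R) : R := t * b 0 i + a 0 i.
(* [f0] is the difference on the line, [f1] and [f2] are its first two derivatives; the isotropy
   hypothesis makes the derivative of [f2] zero. *)
pose f0 (t : R) : R := spray L i (x, t *: b + a) - Phi * (L (x, t *: b + a) * c t).
pose f1 (t : R) : R := dy b (spray L i) (x, t *: b + a)
  - Phi * (dy b L (x, t *: b + a) * c t + L (x, t *: b + a) * b 0 i).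
pose f2 (t : R) : R := dy b (dy b (spray L i)) (x, t *: b + a)
  - Phi * (dy b (dy b L) (x, t *: b + a) * c t
           + 2 * dy b L (x, t *: b + a) * b 0 i).
have f0E : forall t, f0 t = f0 0 + f1 0 * t + 2^-1 * f2 0 * t ^+ 2.
  apply: (is_derive_cst_quadratic (f1 := f1) (f2 := f2)) => t.
  - by apply: is_derive_eq; rewrite /GRing.scale /= /f1 /c; ring.
  - by apply: is_derive_eq; rewrite /GRing.scale /= /f2 /c; ring.
  - apply: is_derive_eq; rewrite /GRing.scale /= /c.
    rewrite [X in X + _](iso i b _ (Uab t).2) !mxE; ring.
exists (f0 0), (f1 0), (2^-1 * f2 0) => t; rewrite -f0E /h /f0 !mxE//.
Qed.

(** Along $y^k\partial_{x^k} - 2Q^i\partial_{y^i}$ the energy $E$ has derivative $4\Phi L^3$ at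
    $(x,y)$, and $E(x,-y)$ has derivative $-4\Phi r^3 L^3$, the opposite sign coming from the
    evenness of $Q$. The combination $E(x,-y) - r^2 E(x,y)$ is maximal there, so its derivative
    $-4\Phi r^2 L^3 (1+r)$ is zero. *)
Lemma isotropic_factor_eq0 (Phi r : R) x y : (1 < n)%N -> slit U (x, y) -> 0 <= r ->
  (forall i w y, y <> 0 -> dy w (dy w (dy w (spray L i))) (x, y) =
     Phi * (3 * dy w (dy w L) (x, y) * w 0 i
            + dy w (dy w (dy w L)) (x, y) * y 0 i)) ->
  (forall z, slit U z -> L (z.1, - z.2) <= r * L z) ->
  L (x, - y) = r * L (x, y) ->
  Phi = 0.
Proof.
move=> n1 Uz r0 iso Lr Lxy; have [/= Ux y0] := Uz.
have even := spray_even n1 Ux iso.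
pose neg (z : Z) : Z := (z.1, - z.2).
have slitN z : slit U z -> slit U (neg z).
  by move=> [Uz1 z0]; split=> //= /eqP; rewrite oppr_eq0 => /eqP.
have UNz : slit U (x, - y) := slitN _ Uz.
(* [Q] is the quadratic part of the spray; by [even] the same vector serves at [y] and at [- y]. *)
pose Q : X := \row_i (spray L i (x, y) - Phi * (L (x, y) * y 0 i)).
have QE : \row_i spray L i (x, y) = Q + (Phi * L (x, y)) *: y.
  by apply/rowP => i; rewrite !mxE; ring.
have QNE : \row_i spray L i (x, - y) = Q + (Phi * L (x, - y)) *: - y.
  apply/rowP => i; rewrite !mxE -even//; ring.
have dE := smooth_diff Es Uz; have dEN := smooth_diff Es UNz.
have := spray_energy LF Uz; rewrite QE [X in _ = 2 * X](dy_linear _ _ _ dE).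
rewrite [X in _ + _ * X](euler oU Es Eh Uz) => spE.
have := spray_energy LF UNz; rewrite QNE [X in _ = 2 * X](dy_linear _ _ _ dEN).
rewrite [X in _ + _ * X](euler oU Es Eh UNz) => spEN.
(* Squares replace the quotient: the bound by [r] says that [m] is nonpositive, and it vanishes at
   $(x,y)$. *)
pose m : Z -> R^o := (energy L \o neg) - r ^+ 2 *: energy L.
have dneg z : differentiable neg z.
  apply: differentiable_pair; first by apply: linear_differentiable => ?; exact: cvg_fst.
  apply: (@differentiableN _ _ _ (snd : Z -> X)).
  by apply: linear_differentiable => ?; exact: cvg_snd.
have dm z : slit U z -> differentiable m z.
  move=> Uz'; apply: differentiableB.
    by apply: differentiable_comp => //; exact: smooth_diff Es (slitN _ Uz').
  by apply: differentiableZ; exact: smooth_diff Es Uz'.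
have m0 : m (x, y) = 0.
  by rewrite /m /energy !fctE /= Lxy /GRing.scale /=; ring.
have mle z : slit U z -> m z <= m (x, y).
  move=> Uz'; rewrite m0 /m /energy !fctE /= /GRing.scale /= subr_le0.
  have -> : r ^+ 2 * (L z * L z) = (r * L z) * (r * L z) by ring.
  by apply: ler_pM; rewrite ?(lf_ge0 LF)// Lr.
pose zeta : Z := (y, - 2 *: Q).
have := derive_local_max zeta (open_slit oU) Uz dm mle.
have Dneg : 'D_zeta (energy L \o neg : Z -> R^o) (x, y) = 'D_(neg zeta) (energy L) (x, - y).
  rewrite /derive; set g1 := fun h => h^-1 *: _; set g2 := fun h => h^-1 *: _.
  suff -> : g1 = g2 by [].
  apply/funext => h; rewrite /g1 /g2 /=; congr (_ *: (energy L (_, _) - _)).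
  by rewrite /= opprD !scalerN.
have cneg : derivable (energy L \o neg : Z -> R^o) (x, y) zeta.
  by apply: diff_derivable; exact: differentiable_comp.
have cE : derivable (energy L) (x, y) zeta by exact: diff_derivable.
rewrite deriveB//; last exact: derivableZ.
have negE : neg zeta = (y, 2 *: Q) by congr (_, _); rewrite /= -scaleNr opprK.
rewrite Dneg deriveZ// negE [X in X - _](derive_dxdy _ _ dEN).
rewrite [X in _ - _ *: X](derive_dxdy _ _ dE) [X in _ + X - _](dy_scale _ _ dEN).
rewrite [X in _ - _ *: (_ + X)](dy_scale _ _ dE).
move: spEN; rewrite -[X in dx X _ _]scaleN1r [LHS](dx_scale _ _ dEN).
rewrite spE => {spE}; set a := dx _ _ _; set b := dy _ _ _; set c := dy _ _ _.
rewrite /energy !fctE Lxy /GRing.scale /= => spEN.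
have -> : a = - 2 * (b + Phi * (r * L (x, y)) * (2%:R * (r * L (x, y) * (r * L (x, y))))).
  by apply: oppr_inj; rewrite -[LHS]mulN1r spEN; ring.
(* Positivity of [L] at both [y] and [- y] gives $r > 0$, without which $r^2$ could not be
   cancelled. *)
have L0 := L_gt0 LF Uz; have := L_gt0 LF UNz; rewrite Lxy (pmulr_lgt0 _ L0) => rp.
set l := L (x, y) in L0 *.
move=> eq0; have : Phi * (4 * r ^+ 2 * l ^+ 3 * (1 + r)) = 0.
  by rewrite -[RHS]oppr0 -eq0; ring.
move/eqP; rewrite mulf_eq0 => /orP[/eqP//|].
by rewrite gt_eqF// !mulr_gt0// ?exprn_gt0// addr_gt0.
Qed.

End LocalIsotropic.

(** * Charts and tangent vectors *)

Section Charts.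
Context {R : realType} {n : nat} {M : topologicalType} (A : manifold R n M).
Implicit Types (c : chart R n M) (p : M) (x y : 'rV[R]_n).

(** Within the open image of [dom c], this set is the preimage of [D] under [bwd c], which is
    continuous there. *)
Lemma open_chart_preimage c (D : set M) : open D -> open (c @` (dom c `&` D)).
Proof.
move=> oD.
have -> : c @` (dom c `&` D) = (c @` dom c) `&` (bwd c @^-1` D).
  apply/seteqP; split=> [_ [p [cp Dp] <-]|_ [[p cp <-]]]; rewrite /preimage/=.
    by rewrite bwdK//; split=> //; exists p.
  by rewrite bwdK// => Dp; exists p.
rewrite openE => x [Ux Dx]; rewrite /interior; apply: filterI.
  by apply: open_nbhs_nbhs; split=> //; exact: img_open.
have := @bwd_cont _ _ _ c; rewrite (continuous_open_subspace _ (@img_open _ _ _ c)) => /(_ x).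
by rewrite inE => /(_ Ux); apply; exact: open_nbhs_nbhs.
Qed.

Lemma chart_bwd c x : (c @` dom c) x -> dom c (bwd c x) /\ c (bwd c x) = x.
Proof. by move=> [p cp <-]; rewrite bwdK. Qed.

Lemma chart_at_bwd c x : atlas A c -> (c @` dom c) x -> chart_at A (bwd c x) c.
Proof. by move=> Ac /chart_bwd[]. Qed.

Lemma chart_at_dom c p : chart_at A p c -> (c @` dom c) (c p).
Proof. by move=> [_ cp]; exists p. Qed.

Lemma differentiable_transition c c' p : chart_at A p c -> chart_at A p c' ->
  differentiable (c' \o bwd c) (c p).
Proof.
move=> [Ac cp] [Ac' c'p].
have [d _] := atlas_compat Ac Ac' 1%N.
by apply: d; exists p.
Qed.

Lemma diff_transition_id c p : chart_at A p c -> 'd (c \o bwd c) (c p) = id :> (_ -> _).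
Proof.
move=> [_ cp]; rewrite -[RHS](@diff_val _ _ _ _ _ id id (is_diff_id (c p))).
apply: esym; apply: diff_near => //.
apply: near_open (@img_open _ _ _ c) _ _; first by exists p.
by move=> x /chart_bwd[_ cx] /=; rewrite cx.
Qed.

(** The chain rule; the direct transition and the composite through [c'] are compared on the image
    of [dom c] and [dom c'] intersected, a neighbourhood of [c p]. *)
Lemma diff_transition_comp c c' c'' p y :
  chart_at A p c -> chart_at A p c' -> chart_at A p c'' ->
  'd (c'' \o bwd c) (c p) y = 'd (c'' \o bwd c') (c' p) ('d (c' \o bwd c) (c p) y).
Proof.
move=> Cp Cp' Cp''.
have d1 := differentiable_transition Cp Cp'; have d2 := differentiable_transition Cp' Cp''.
have c'E : (c' \o bwd c) (c p) = c' p by rewrite /= (bwdK Cp.2).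
rewrite -c'E in d2 *.
have compE := congr1 (fun g : 'rV[R]_n -> 'rV[R]_n => g y) (diff_comp d1 d2).
rewrite -[RHS]compE.
have d12 := differentiable_comp d1 d2.
suff nearE : \forall x \near c p,
    ((c'' \o bwd c') \o (c' \o bwd c)) x = (c'' \o bwd c) x.
  have diffE := diff_near nearE d12.
  exact: (congr1 (fun g : 'rV[R]_n -> 'rV[R]_n => g y) (esym diffE)).
apply: (@near_open _ _ (c @` (dom c `&` dom c'))).
- by apply: open_chart_preimage; exact: dom_open.
- by exists p => //; split; [exact: Cp.2|exact: Cp'.2].
by move=> _ [q [cq c'q] <-]; rewrite /= !bwdK.
Qed.

(** The transformation law carries the coordinates in [c] to every other chart around [p], and
    elsewhere both families take the conventional value 0. *)
Lemma tangent_inj c p (u v : tangent A p) : chart_at A p c -> u c = v c -> u = v.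
Proof.
move=> Cp uv; apply: val_inj; apply/funext => c' /=.
have /asboolP[u0 uE] := coordP u; have /asboolP[v0 vE] := coordP v.
have [Cp'|Cp'] := pselect (chart_at A p c'); last by rewrite u0// v0.
by rewrite (uE _ _ Cp Cp') (vE _ _ Cp Cp') uv.
Qed.

(** [tvec] is a choice with default 0, so a tangent vector with these coordinates must be exhibited:
    [y] is transported by the differentials of the transition maps, which form a cocycle. *)
Lemma tvec_coord c p y : chart_at A p c -> tvec A c p y c = y.
Proof.
move=> Cp.
suff : exists v : tangent A p, v c = y by move=> /(xgetPex 0).
pose v c' : 'rV[R]_n := if `[< chart_at A p c' >] then 'd (c' \o bwd c) (c p) y else 0.
have vE c' : chart_at A p c' -> v c' = 'd (c' \o bwd c) (c p) y.
  by rewrite /v; case: asboolP.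
have vP : v \in tangent_pred A p.
  apply/asboolP; split=> [c' /asboolPn Cp'|c' c'' Cp' Cp''].
    by rewrite /v (negPf Cp').
  by rewrite !vE//; exact: diff_transition_comp.
by exists (Tangent vP); rewrite /= vE// diff_transition_id.
Qed.

Lemma tvecK c p (v : tangent A p) : chart_at A p c -> tvec A c p (v c) = v.
Proof. by move=> Cp; apply: (tangent_inj Cp); rewrite tvec_coord. Qed.

Lemma coordD c p (u v : tangent A p) : (u + v) c = u c + v c.
Proof. by []. Qed.

Lemma coordZ c p (a : R) (v : tangent A p) : (a *: v) c = a *: v c.
Proof. by []. Qed.

Lemma coordN c p (v : tangent A p) : (- v) c = - v c.
Proof. by []. Qed.

Lemma tvecD c p y z : chart_at A p c ->
  tvec A c p (y + z) = tvec A c p y + tvec A c p z.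
Proof. by move=> Cp; apply: (tangent_inj Cp); rewrite coordD !tvec_coord. Qed.

Lemma tvecZ c p (a : R) y : chart_at A p c ->
  tvec A c p (a *: y) = a *: tvec A c p y.
Proof. by move=> Cp; apply: (tangent_inj Cp); rewrite coordZ !tvec_coord. Qed.

Lemma tvecN c p y : chart_at A p c -> tvec A c p (- y) = - tvec A c p y.
Proof. by move=> Cp; apply: (tangent_inj Cp); rewrite coordN !tvec_coord. Qed.

Lemma tvec_neq0 c p y : chart_at A p c -> y <> 0 -> tvec A c p y <> 0.
Proof. by move=> Cp y0 yE; apply: y0; rewrite -(tvec_coord y Cp) yE. Qed.

Lemma exists_chart_at p : exists c, chart_at A p c.
Proof. by have [c Ac cp] := atlas_cover A p; exists c. Qed.

(* If the differential is not well defined, both sides are the default value [0]. *)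
Lemma tmapN (phi : M -> M) p (v : tangent A p) : tmap phi (- v) = - tmap phi v.
Proof.
have [c Cp] := exists_chart_at p; have [c' Cp'] := exists_chart_at (phi p).
rewrite /tmap; set S := fun v : tangent A p => [set w : tangent A (phi p) |
  forall c c', chart_at A p c -> chart_at A (phi p) c' ->
    w c' = 'd (c' \o phi \o bwd c) (c p) (v c)].
have SN u w : S u w -> S (- u) (- w).
  by move=> Sw d d' Dp Dp'; rewrite !coordN (Sw d d')// linearN.
rewrite -/(S v) -/(S (- v)).
have [[w Sw]|NS] := pselect (exists w, S v w).
  apply: (tangent_inj Cp').
  have S1 := xgetPex 0 (ex_intro _ _ (SN _ _ Sw)).
  have S2 := SN _ _ (xgetPex 0 (ex_intro _ _ Sw)).
  by rewrite (S1 c c')// (S2 c c').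
rewrite !xgetPN ?oppr0// => w Sw; apply: NS; first by exists w.
by exists (- w); rewrite -[v]opprK; exact: SN.
Qed.

End Charts.

(** * Chart expressions of the Finsler tensors *)

Section FinslerChart.
Context {R : realType} {n : nat} {M : topologicalType} {A : manifold R n M}.
Variable F : forall p, tangent A p -> R.
Local Notation X := 'rV[R]_n.
Local Notation Z := (X * X)%type.
Implicit Types (c : chart R n M) (p : M) (x y u v w : X) (f : Z -> R^o).

Definition Fchart c : Z -> R^o := fun z => Floc F c z.1 z.2.

Lemma derive_slice f x v :
  'D_v (fun y => f (x, y) : R^o) = (fun y => dy v f (x, y)).
Proof. by apply/funext => y; rewrite dyE. Qed.

Lemma derive1_dy f x u v : derive1 (fun t : R => f (x, u + t *: v) : R^o) 0 = dy v f (x, u).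
Proof.
rewrite derive1E dyE; have := derive_line (fun y => f (x, y)) u v (0 : R).
rewrite scale0r add0r => ->; rewrite (_ : (fun _ => _) = fun t : R => f (x, t *: v + u))//.
by apply/funext => t; rewrite addrC.
Qed.

(** Affine lines in the tangent space are affine lines in coordinates, so both sides are the same
    iterated derivative. *)
Lemma fund_tensorE c x y u v : chart_at A (bwd c x) c ->
  fund_tensor F (tvec A c (bwd c x) y) (tvec A c _ u) (tvec A c _ v)
  = 2^-1 * dy u (dy v (energy (Fchart c))) (x, y).
Proof.
move=> Cx; rewrite /fund_tensor; congr (_ * _); rewrite -derive1_dy.
congr (derive1 _ 0); apply/funext => s; rewrite -derive1_dy.
congr (derive1 _ 0); apply/funext => t.
by rewrite /energy !fctE /Fchart /Floc /= -expr2 -!tvecZ// -!tvecD.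
Qed.

Lemma gmatE c x y : chart_at A (bwd c x) c -> gmat F c x y = hess (Fchart c) (x, y).
Proof. by move=> Cx; apply/matrixP => i j; rewrite mxE fund_tensorE// mxE. Qed.

Lemma spray_coefE c i x y : chart_at A (bwd c x) c ->
  spray_coef F c i x y = spray (Fchart c) i (x, y).
Proof.
move=> Cx; rewrite /spray_coef /spray gmatE//; congr (_ * _).
have F2E : F2 F c = (fun x y => energy (Fchart c) (x, y)).
  by apply/funext => x'; apply/funext => y'; rewrite /F2 /energy !fctE -expr2.
apply: eq_bigr => m _; congr (_ * _); rewrite /spray_rhs F2E; congr (_ - _).
  apply: eq_bigr => k _; congr (_ * _); rewrite dxE.
  by congr ('D_ _ _ _); apply/funext => x'; rewrite dyE.
by rewrite dxE.
Qed.

Lemma berwald_coefE c i j k l x y : chart_at A (bwd c x) c ->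
  berwald_coef F c i j k l x y =
  dy (delta_mx 0 j) (dy (delta_mx 0 k) (dy (delta_mx 0 l) (spray (Fchart c) i))) (x, y).
Proof.
move=> Cx; rewrite /berwald_coef.
have -> : spray_coef F c i x = (fun y => spray (Fchart c) i (x, y)).
  by apply/funext => y'; rewrite spray_coefE.
rewrite (derive_slice (spray (Fchart c) i)) (derive_slice (dy _ (spray (Fchart c) i))).
by rewrite [RHS]dyE.
Qed.

Hypothesis finslerF : finsler_metric F.

(** Doubling the zero vector gives $F(0) = 2F(0)$. *)
Lemma finsler0 p : F (0 : tangent A p) = 0.
Proof.
have [_ _ Fh _] := finslerF; have := Fh p 0 2 (ltr0n _ 2).
rewrite scaler0 => /eqP; rewrite -subr_eq0 -{1}[F _]mul1r -mulrBl mulf_eq0.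
rewrite (_ : 1 - 2 = -1); last by ring.
by rewrite oppr_eq0 oner_eq0 /= => /eqP.
Qed.

Lemma local_finsler_chart c : atlas A c -> local_finsler (c @` dom c) (Fchart c).
Proof.
move=> Ac; have [F0 Fs Fh Fp] := finslerF; split.
- exact: img_open.
- exact: Fs.
- move=> s [x y] s0 [/= Ux y0]; rewrite /Fchart /Floc /= expr1.
  by rewrite tvecZ ?Fh//; exact: chart_at_bwd.
- by move=> z; exact: F0.
- move=> [x y] u [/= Ux y0] u0; have Cx := chart_at_bwd Ac Ux.
  have := Fp _ _ _ (tvec_neq0 Cx y0) (tvec_neq0 Cx u0).
  by rewrite fund_tensorE// pmulr_rgt0// invr_gt0.
Qed.

Lemma cartan_torsionE c x y w : atlas A c -> (c @` dom c) x -> y <> 0 ->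
  cartan_torsion F (tvec A c (bwd c x) y) (tvec A c _ w) (tvec A c _ w) (tvec A c _ w)
  = 4^-1 * dy w (dy w (dy w (energy (Fchart c)))) (x, y).
Proof.
move=> Ac Ux y0; have Cx := chart_at_bwd Ac Ux; have LF := local_finsler_chart Ac.
have Uz : slit (c @` dom c) (x, y) by [].
pose f : Z -> R^o := 2^-1 *: dy w (dy w (energy (Fchart c))).
have -> : 4^-1 * dy w (dy w (dy w (energy (Fchart c)))) (x, y) = 2^-1 * dy w f (x, y).
  rewrite [X in _ = _ * X](dyZ _ _ (smooth_dy w (smooth_dy w (smooth_energy LF))) Uz).
  by field.
rewrite /cartan_torsion -derive1_dy; congr (_ * _); congr (derive1 _ 0).
by apply/funext => t; rewrite -tvecZ// -tvecD// fund_tensorE.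
Qed.

(* Only the cubic form [B_y(w, w, w)] is used, which makes symmetry of higher
   derivatives unnecessary. *)
Lemma isotropic_chart (Phi : M -> R) c x y w i :
  (forall c p (y u v w : tangent A p), chart_at A p c -> y <> 0 ->
    berwald_curv F c y u v w =
    (Phi p * (F y)^-1) *:
      (angular_form F y u v *: frakB F y w + angular_form F y v w *: frakB F y u
       + angular_form F y w u *: frakB F y v
       + (2 * F y * cartan_torsion F y u v w) *: ell F y)) ->
  atlas A c -> (c @` dom c) x -> y <> 0 ->
  dy w (dy w (dy w (spray (Fchart c) i))) (x, y) =
    Phi (bwd c x) * (3 * dy w (dy w (Fchart c)) (x, y) * w 0 i
      + dy w (dy w (dy w (Fchart c))) (x, y) * y 0 i).
Proof.
move=> iso Ac Ux y0; have Cx := chart_at_bwd Ac Ux; have LF := local_finsler_chart Ac.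
have Uz : slit (c @` dom c) (x, y) by [].
have oU := lf_open LF; have Es := smooth_energy LF.
set Y := tvec A c (bwd c x) y; set W := tvec A c (bwd c x) w.
have := iso c _ Y W W W Cx (tvec_neq0 Cx y0).
move=> /(congr1 (fun v : tangent A (bwd c x) => v c 0 i)).
rewrite /berwald_curv tvec_coord// mxE !tvec_coord//.
have [_ cbx] := chart_bwd Ux; rewrite cbx.
have -> : \sum_j \sum_k \sum_l berwald_coef F c i j k l x y * w 0 j * w 0 k * w 0 l
    = dy w (dy w (dy w (spray (Fchart c) i))) (x, y).
  rewrite [RHS](dy3_sum _ _ _ oU (smooth_spray LF i) Uz).
  apply: eq_bigr => j _; apply: eq_bigr => k _; apply: eq_bigr => l _.
  by rewrite berwald_coefE.
move=> ->.
set l := Fchart c (x, y); have FY : F Y = l by [].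
have l0 : l != 0 by rewrite gt_eqF// (L_gt0 LF Uz).
set a := dy w (Fchart c) (x, y); set b := dy w (dy w (Fchart c)) (x, y).
set d := dy w (dy w (dy w (Fchart c))) (x, y).
have gWW : fund_tensor F Y W W = a ^+ 2 + l * b.
  by rewrite fund_tensorE// [X in _ * X](dy2_energy LF w Uz) -/l -/a -/b; field.
have gYW : fund_tensor F Y Y W = l * a.
  rewrite fund_tensorE// (euler oU (smooth_dy w Es) (homy_dy w oU Es (homy_energy LF)) Uz).
  by rewrite [X in _ * (_ * X)](dy_energy LF w Uz) -/l -/a; field.
have gWl : fund_tensor F Y W (ell F Y) = a.
  rewrite /ell FY -tvecZ// fund_tensorE//.
  have -> : dy w (dy (l^-1 *: y) (energy (Fchart c))) (x, y)
      = dy w (l^-1 *: dy y (energy (Fchart c))) (x, y).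
    apply: (eq_dy _ oU Uz) => z' Uz'.
    by rewrite [LHS](dy_scale _ _ (smooth_diff Es Uz')).
  rewrite [X in _ * X](dyZ _ _ (smooth_dy y Es) Uz) [X in _ * (_ * X)](dy_dy_energy LF w Uz).
  by rewrite [X in _ * (_ * X)](dy_energy LF w Uz) -/l -/a; field.
have CW : cartan_torsion F Y W W W = 2^-1 * (3 * (a * b) + l * d).
  by rewrite cartan_torsionE// [X in _ * X](dy3_energy LF w Uz) -/l -/a -/b -/d; field.
(* Here $\mathbf{h}_y(w,w) = lb$ and $2F\mathbf{C}_y(w,w,w)\ell = (3ab + ld)y$. The $ab$ terms from
   $\mathfrak{B}_y(w) = w - (a/l)y$ and from the torsion cancel, leaving $\Phi(3bw^i + dy^i)$. *)
rewrite coordZ !coordD !coordZ /frakB /angular_form coordD coordN coordZ /ell coordZ.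
rewrite !tvec_coord// FY gWW gYW gWl CW !mxE.
by field.
Qed.

End FinslerChart.

(** * Dimension one, asymmetry of homogeneous metrics, and the theorem *)

Section Homogeneous.
Context {R : realType} {n : nat} {M : topologicalType} {A : manifold R n M}.
Variable F : forall p, tangent A p -> R.
Hypothesis finslerF : finsler_metric F.
Local Notation X := 'rV[R]_n.
Implicit Types (c : chart R n M) (p : M) (x y : X).

(* In dimension at most one, [y] spans every coordinate direction, so Euler's
   identity kills the last derivative of the 0-homogeneous second one. *)
Lemma berwald_coef_dim1 c i j k l x y : (n <= 1)%N -> atlas A c ->
  (c @` dom c) x -> y <> 0 -> berwald_coef F c i j k l x y = 0.
Proof.
move=> n1 Ac Ux y0; have LF := local_finsler_chart finslerF Ac.
have oU := lf_open LF; have Cx := chart_at_bwd Ac Ux.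
have Uz : slit (c @` dom c) (x, y) by [].
have sub1 (a b : 'I_n) : a = b.
  apply: val_inj => /=; have := leq_trans (ltn_ord a) n1; have := leq_trans (ltn_ord b) n1.
  by rewrite !ltnS !leqn0 => /eqP -> /eqP ->.
have yE : y = y 0 j *: delta_mx 0 j.
  by apply/rowP => a; rewrite !mxE (sub1 a j) !eqxx mulr1.
have yj0 : y 0 j != 0 by apply/eqP => yj; apply: y0; rewrite yE yj scale0r.
rewrite berwald_coefE//.
have Gs := smooth_spray LF i; have Gl := smooth_dy (delta_mx 0 l) Gs.
have Glk := smooth_dy (delta_mx 0 k) Gl.
have Gh := homy_dy (delta_mx 0 k) oU Gl (homy_dy (delta_mx 0 l) oU Gs (homy_spray LF i)).
have := dy_scale (y 0 j) (delta_mx 0 j) (smooth_diff Glk Uz).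
rewrite -yE [LHS](euler oU Glk Gh Uz) mul0r => /esym/eqP.
by rewrite mulf_eq0 (negPf yj0) => /eqP.
Qed.

(** The quotient $F(-y)/F(y)$ is continuous on the unit sphere, which is compact and, as $n > 0$,
    nonempty; being 0-homogeneous, it attains there its maximum over all nonzero vectors. *)
Lemma exists_max_asymmetry c x : (0 < n)%N -> atlas A c -> (c @` dom c) x ->
  exists r y, [/\ 0 <= r, y <> 0, Fchart F c (x, - y) = r * Fchart F c (x, y)
    & forall v, v <> 0 -> Fchart F c (x, - v) <= r * Fchart F c (x, v)].
Proof.
move=> n0 Ac Ux; have LF := local_finsler_chart finslerF Ac.
pose L := Fchart F c; pose S : set X := [set y | `|y| = 1].
have S0 y : S y -> y <> 0.
  by rewrite /S /= => + y0; rewrite y0 normr0 => /eqP; rewrite eq_sym oner_eq0.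
have slit1 y : y <> 0 -> slit (c @` dom c) (x, y) by [].
have slitN y : y <> 0 -> slit (c @` dom c) (x, - y).
  by move=> y0; split=> //= /eqP; rewrite oppr_eq0 => /eqP.
have Lpos y : y <> 0 -> 0 < L (x, y) by move=> y0; exact: (L_gt0 LF (slit1 _ y0)).
pose f y : R := L (x, - y) / L (x, y).
have Ldiff y : y <> 0 -> differentiable (fun v => L (x, v)) y.
  move=> y0; apply: (@differentiable_comp _ _ _ _ (fun v : X => (x, v)) L).
    by apply: differentiable_pair => //; exact: differentiable_cst.
  exact: smooth_diff (lf_smooth LF) (slit1 _ y0).
have fcont : {within S, continuous f}.
  apply: continuous_in_subspaceT => y; rewrite inE => /S0 y0.
  apply: differentiable_continuous.
  apply: (@differentiableM _ _ (fun v => L (x, - v)) (fun v => (L (x, v))^-1)).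
    apply: (@differentiable_comp _ _ _ _ (fun v : X => - v) (fun v => L (x, v))) => //.
    by apply: Ldiff; exact: (slitN _ y0).2.
  by apply: differentiableV; [exact: Ldiff|rewrite gt_eqF// Lpos].
have Sc : compact S.
  apply: bounded_closed_compact.
    by exists 1; split=> // e e1 y /= ->; exact: ltW.
  rewrite (_ : S = (fun y : X => `|y|) @^-1` [set 1])//.
  by apply: closed_comp => [y _|]; [exact: norm_continuous|exact: closed_eq].
have SN (v : X) : v <> 0 -> S (`|v|^-1 *: v).
  move=> /eqP v0; rewrite /S /= normrZ normfV normr_id mulVf//.
  by rewrite normr_eq0.
have [e e0] : exists e : X, e <> 0.
  exists (const_mx 1) => /rowP/(_ (Ordinal n0)); rewrite !mxE => /eqP.
  by rewrite oner_eq0.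
have [y + ymax] := EVT_max_rV (ex_intro _ _ (SN _ e0)) Sc fcont.
rewrite inE => /S0 y0; exists (f y), y; split=> //.
- by rewrite divr_ge0 ?(lf_ge0 LF).
- by rewrite /f divfK// gt_eqF// Lpos.
(* Normalising [v] multiplies numerator and denominator by the same factor, so the bound on the
   sphere extends to [v]. *)
move=> v v0; have v0' : 0 < `|v|^-1 by rewrite invr_gt0 normr_gt0; exact/eqP.
rewrite -ler_pdivrMr; last exact: Lpos.
have := ymax (`|v|^-1 *: v); rewrite inE => /(_ (SN _ v0)).
rewrite /f -scalerN -/(scaly _ (x, - v)) -/(scaly _ (x, v)).
have LNv := lf_homy LF v0' (slitN _ v0); have Lv := lf_homy LF v0' (slit1 _ v0).
rewrite [X in X / _ <= _](_ : _ = `|v|^-1 * L (x, - v)); last exact: LNv.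
rewrite [X in _ / X <= _](_ : _ = `|v|^-1 * L (x, v)); last exact: Lv.
by rewrite -mulf_div divff ?mul1r// gt_eqF.
Qed.

(** An isometry that carries [q] to [p] has an odd differential, so the bound at [p] pulls back to
    [q]. *)
Lemma homogeneous_asymmetry p (r : R) : homogeneous F ->
  (forall v : tangent A p, F (- v) <= r * F v) ->
  forall q (v : tangent A q), F (- v) <= r * F v.
Proof.
move=> homF Fp q v; have [phi [_ iso] phiq] := homF q p.
by move: Fp; rewrite -phiq => /(_ (tmap phi v)); rewrite -tmapN !iso.
Qed.

End Homogeneous.

Theorem theorem1p4 (R : realType) (n : nat) (M : topologicalType)
    (A : manifold R n M) (F : forall p : M, tangent A p -> R)
    (connM : connected [set: M])
    (finslerF : finsler_metric F)
    (homF : homogeneous F)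
    (isoF : isotropic_berwald F) :
  locally_minkowskian F \/ riemannian F \/ berwald F \/
  (randers F /\ berwald F).
Proof.
(* The third alternative, a Berwald metric, is the one that always holds. *)
right; right; left => c p y u v w Cp y0.
have [Phi _ iso] := isoF.
have [Ac cp] := Cp; have Ux := chart_at_dom Cp.
have bwdp : bwd c (c p) = p := bwdK cp.
(* Evenness of the quadratic part requires a vector independent of [y], so dimension at most one is
   treated apart, by homogeneity of the spray. *)
have [n1|n1] := leqP n 1%N.
  have yc0 : y c <> 0 by move=> yc; apply: y0; exact: (tangent_inj Cp).
  rewrite /berwald_curv; apply: (tangent_inj Cp); rewrite tvec_coord//.
  apply/rowP => i; rewrite !mxE; apply: big1 => j _; apply: big1 => k _.
  apply: big1 => l _.
  by rewrite (berwald_coef_dim1 finslerF)// !mul0r.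
rewrite (iso c p)//; suff -> : Phi p = 0 by rewrite mul0r scale0r.
have [r [y1 [r0 y10 y1max ymax]]] :=
  exists_max_asymmetry finslerF (ltnW n1) Ac Ux.
have F0 q := finsler0 finslerF q.
have Fp : forall v : tangent A p, F p (- v) <= r * F p v.
  (* The maximum concerns nonzero vectors; at zero both sides vanish. *)
  move=> v'; have [v'0|v'0] := pselect (v' c = 0).
    have -> : v' = 0 by apply: (tangent_inj Cp).
    by rewrite oppr0 F0 mulr0.
  have := ymax _ v'0; rewrite /Fchart /Floc /= bwdp.
  by rewrite tvecN// tvecK.
(* Homogeneity extends the bound from [p] to all points, so that $(p,y_1)$ is maximal in horizontal
   directions as well. *)
have Fq := homogeneous_asymmetry homF Fp.
have LF := local_finsler_chart finslerF Ac.
rewrite -bwdp.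
apply: (isotropic_factor_eq0 LF (r := r) (x := c p) (y := y1)) => //.
  by move=> i w' y' y'0; exact: isotropic_chart.
move=> [x y'] [/= Ux' y'0]; rewrite /Fchart /Floc /=.
by rewrite tvecN; [exact: Fq|exact: chart_at_bwd].
Qed.
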